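(* Let $M_{19}$ be a compact nilmanifold corresponding to the Lie algebra $\mathfrak{h}^-_{19}$, endowed with the invariant balanced Hermitian structure $(J,g)$ described in the context, with torsion $T$, Bismut-Strominger connection $\nabla^+$ and Chern connection $\nabla^c$. For $\lambda,\mu\in\mathbb{R}$ let $A_{\lambda,\mu}$ be the $SU(3)$-instanton described in the context. (i) If $\mu^2=\frac4{15}$, then $dT=4\pi^2\big(p_1(\nabla^+)-p_1(A_{\lambda,\mu})\big)$. (ii) If $\mu=0$, then $p_1(A_{\lambda,0})=0$ and $dT=4\pi^2\big(p_1(\nabla^c)-p_1(A_{\lambda,0})\big)$. Hence one obtains solutions $(M_{19},J,g,A_{\lambda,\mu})$ to the heterotic supersymmetry equations with non-zero flux $H=T$ and constant dilaton satisfying the three-form Bianchi identity for the $(+)$-connection (when $\mu^2=\frac4{15}$) and for the Chern connection (when $\mu=0$).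
   Context: Notation: $e^{ij}=e^i\wedge e^j$, etc. A compact nilmanifold is $\Gamma\backslash G$ with $G$ simply connected nilpotent and $\Gamma$ a lattice. The structure: $\mathfrak{h}^-_{19}$ is the $3$-step nilpotent Lie algebra having a basis of $1$-forms with $de^1=de^2=de^5=0$, $de^3=2e^{15}$, $de^4=2e^{25}$, $de^6=2(e^{13}+e^{24})$. The metric is $g=\sum_ie^i\otimes e^i$, and with $(Je)(X)=-e(JX)$ the complex structure is $Je^1=-e^2$, $Je^3=-e^4$, $Je^5=-e^6$ (on the dual frame: $JE_2=E_1$, $JE_4=E_3$, $JE_6=E_5$). The Kaehler form $F(X,Y)=g(X,JY)$ is $F=e^{12}+e^{34}+e^{56}$. Connections: $T(X,Y,Z)=-dF(JX,JY,JZ)$; $g(\nabla^+_XY,Z)=g(\nabla^g_XY,Z)+\frac12T(X,Y,Z)$ and $g(\nabla^c_XY,Z)=g(\nabla^g_XY,Z)+\frac12dF(JX,Y,Z)$, with $\nabla^g$ the Levi-Civita connection. Balanced means $d*F=0$ (Lee form zero). The connection $A_{\lambda,\mu}$ on $TM_{19}$ is the $U(3)$-connection whose connection forms $\sigma^i_j(X)=g(\nabla^{A}_XE_j,E_i)=-\sigma^j_i(X)$ are $\sigma^2_3=\sigma^2_5=\sigma^4_5=-\lambda e^1-\mu e^6$ and $\sigma^i_j=\lambda e^1+\mu e^6$ for all other pairs $1\le i<j\le6$. Pontrjagin forms: for a metric connection with connection forms $\omega^i_j$ in an orthonormal frame and curvature forms $\Omega^i_j=d\omega^i_j+\omega^i_k\wedge\omega^k_j$,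 $p_1=\frac1{8\pi^2}\sum_{i<j}\Omega^i_j\wedge\Omega^i_j$. $SU(3)$-instanton: a connection whose curvature $\Omega$ satisfies $\Omega(JX,JY)=\Omega(X,Y)$ and $\sum_{k=1}^6\Omega(E_k,JE_k)=0$. Heterotic supersymmetry equations with constant dilaton for $(M,J,g,A)$: (i) $Hol(\nabla^+)\subset\mathfrak{su}(3)$, i.e. $\sum_i g(R^+(X,Y)JE_i,E_i)=0$; (ii) $(J,g)$ is balanced; (iii) $A$ is an $SU(3)$-instanton. The three-form Bianchi identity for a connection $\nabla$ on $TM$: $dT=\frac{\alpha'}{4}8\pi^2\big(p_1(\nabla)-p_1(A)\big)$ for some constant $\alpha'>0$. *)

(* Defs.v *)
From HB Require Import structures.
From mathcomp Require Import all_boot all_order all_algebra all_fingroup.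
From mathcomp Require Import all_classical all_reals all_analysis.

Set Implicit Arguments.
Unset Strict Implicit.
Unset Printing Implicit Defensive.

Import Order.TTheory GRing.Theory Num.Theory.
Import numFieldNormedType.Exports.
Local Open Scope classical_set_scope.
Local Open Scope ring_scope.

(* A simply connected nilpotent Lie group G of dimension n is diffeomorphic to
   R^n, so its underlying manifold is taken to be 'rV[R]_n; no particular
   global chart is fixed.  Tensors, vector fields and connections on the
   nilmanifold M = Gamma\G are encoded by their pull-backs to G, i.e. by the
   corresponding objects on G that are invariant under the left translations by
   elements of Gamma.  Equalities of such objects on M are equalities on G. *)

Section Calculus.
Context {R : realType}.

Fixpoint Ck (k : nat) {V W : normedModType R} (f : V -> W) : Prop :=
  if k is k'.+1 then
    (forall x, differentiable f x) /\ (forall v, Ck k' (fun x => 'D_v f x))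
  else continuous f.

Definition smooth {V W : normedModType R} (f : V -> W) : Prop :=
  forall k, Ck k f.

End Calculus.

Section Forms.
Context {R : realType} (m : nat).
Let n := m.+1.
Let V := 'rV[R]_n.

Definition vfield := V -> V.

Definition bracket (X Y : vfield) : vfield :=
  fun x => 'D_(X x) Y x - 'D_(Y x) X x.

(* [w x v] is the value at the point [x] of the k-form [w] on the k tangent
   vectors [v 0, ..., v k.-1] *)
Definition form (k : nat) := V -> ('I_k -> V) -> R.

(* (d w)(v_0,...,v_k) = sum_i (-1)^i v_i(w(v_0,...,^v_i,...,v_k)), the v_i being
   extended to constant (hence commuting) vector fields on R^n *)
Definition extd k (w : form k) : form k.+1 := fun x v =>
  \sum_(i < k.+1)
    (-1) ^+ i * 'D_(v i) (fun y => w y (fun j : 'I_k => v (lift i j))) x.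

(* normalised so that (a /\ b)(X,Y) = a(X) b(Y) - a(Y) b(X) for 1-forms *)
Definition wedge p q (a : form p) (b : form q) : form (p + q) := fun x v =>
  (p`! * q`!)%:R^-1 *
  \sum_(s : 'S_(p + q))
    (-1) ^+ s * a x (fun i => v (s (lshift q i)))
              * b x (fun i => v (s (rshift p i))).

End Forms.

Definition vec2 {T : Type} (u v : T) : 'I_2 -> T := tnth [tuple u; v].
Definition vec3 {T : Type} (u v w : T) : 'I_3 -> T := tnth [tuple u; v; w].

Record lieGroup (R : realType) (m : nat) := LieGroup {
  lg_mul : 'rV[R]_m.+1 -> 'rV[R]_m.+1 -> 'rV[R]_m.+1;
  lg_one : 'rV[R]_m.+1;
  lg_inv : 'rV[R]_m.+1 -> 'rV[R]_m.+1;
  lg_mulA : forall a b c, lg_mul a (lg_mul b c) = lg_mul (lg_mul a b) c;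
  lg_mul1 : forall a, lg_mul lg_one a = a;
  lg_mulV : forall a, lg_mul (lg_inv a) a = lg_one;
  lg_mul_smooth :
    smooth (fun p : 'rV[R]_m.+1 * 'rV[R]_m.+1 => lg_mul p.1 p.2);
  lg_inv_smooth : smooth lg_inv }.

Section Invariance.
Context {R : realType} {m : nat} (G : lieGroup R m).
Local Notation V := 'rV[R]_m.+1.

Record lattice (Gam : set V) : Prop := Lattice {
  lattice1 : Gam (lg_one G);
  latticeM : forall a b, Gam a -> Gam b -> Gam (lg_mul G a b);
  latticeV : forall a, Gam a -> Gam (lg_inv G a);
  lattice_discrete : \forall x \near lg_one G, Gam x -> x = lg_one G;
  lattice_cocompact : exists2 K : set V, compact K &
    forall x, exists a k, [/\ Gam a, K k & x = lg_mul G a k] }.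

(* differential at x of the left translation by a *)
Definition dleft (a x v : V) : V := 'D_v (lg_mul G a) x.

(* smooth objects invariant under the left translations by elements of S:
   S = setT gives the left-invariant objects on G, S = Gamma gives the objects
   on the quotient Gamma\G *)
Record inv_function (S : set V) (f : V -> R) : Prop := InvFunction {
  invfun_smooth : smooth f;
  invfun_inv : forall a x, S a -> f (lg_mul G a x) = f x }.

Record inv_vfield (S : set V) (X : V -> V) : Prop := InvVfield {
  invvf_smooth : smooth X;
  invvf_inv : forall a x, S a -> X (lg_mul G a x) = dleft a x (X x) }.

Record inv_form (S : set V) k (w : form (R := R) m k) : Prop := InvForm {
  invform_linear : forall x (v : 'I_k -> V) i c u u',
    w x [eta v with i |-> c *: u + u'] =
    c * w x [eta v with i |-> u] + w x [eta v with i |-> u'];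
  invform_alt : forall x (v : 'I_k -> V) i j, i != j -> v i = v j -> w x v = 0;
  invform_smooth : forall v, smooth (fun x => w x v);
  invform_inv : forall a x v, S a ->
    w (lg_mul G a x) (fun i => dleft a x (v i)) = w x v }.

End Invariance.

Definition ix (k : nat) : 'I_6 := inord k.-1.

(* A compact nilmanifold Gamma\G with Lie algebra h_19^-, together with a basis
   e^1, ..., e^6 of left-invariant 1-forms satisfying the structure equations
   and its dual frame E_1, ..., E_6; e^k is [coframe (ix k)].  Nilpotency of G
   is a consequence of the structure equations. *)
Record h19_nilmanifold (R : realType) := H19Nilmanifold {
  grp :> lieGroup R 5;
  gamma : set 'rV[R]_6;
  gamma_lattice : lattice grp gamma;
  coframe : 'I_6 -> form (R := R) 5 1;
  frame : 'I_6 -> vfield (R := R) 5;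
  coframe_inv : forall i, inv_form grp setT (coframe i);
  frame_inv : forall i, inv_vfield grp setT (frame i);
  dual_frame : forall i j x, coframe i x (fun=> frame j x) = (i == j)%:R;
  d_e1 : forall x v, extd (coframe (ix 1)) x v = 0;
  d_e2 : forall x v, extd (coframe (ix 2)) x v = 0;
  d_e3 : forall x v, extd (coframe (ix 3)) x v =
    2 * wedge (coframe (ix 1)) (coframe (ix 5)) x v;
  d_e4 : forall x v, extd (coframe (ix 4)) x v =
    2 * wedge (coframe (ix 2)) (coframe (ix 5)) x v;
  d_e5 : forall x v, extd (coframe (ix 5)) x v = 0;
  d_e6 : forall x v, extd (coframe (ix 6)) x v =
    2 * (wedge (coframe (ix 1)) (coframe (ix 3)) x v
         + wedge (coframe (ix 2)) (coframe (ix 4)) x v) }.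

Section Geometry.
Context {R : realType} (M : h19_nilmanifold R).
Local Notation V := 'rV[R]_6.
Local Notation E := (frame M).

Definition co (i : 'I_6) (x v : V) : R := coframe M i x (fun=> v).

Definition metric (x v w : V) : R := \sum_i co i x v * co i x w.

(* J E_2 = E_1, J E_4 = E_3, J E_6 = E_5 and J^2 = -1 *)
Definition cplx (x v : V) : V :=
  co (ix 2) x v *: E (ix 1) x - co (ix 1) x v *: E (ix 2) x
  + co (ix 4) x v *: E (ix 3) x - co (ix 3) x v *: E (ix 4) x
  + co (ix 6) x v *: E (ix 5) x - co (ix 5) x v *: E (ix 6) x.

Definition kaehler : form 5 2 := fun x v =>
  metric x (v ord0) (cplx x (v ord_max)).

Definition torsion : form 5 3 := fun x v =>
  - extd kaehler x (fun i => cplx x (v i)).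

(* e^1 /\ ... /\ e^6 *)
Definition volume : form 5 6 := fun x v =>
  \det (\matrix_(i, j) co i x (v j)).

(* Hodge star of a 2-form, oriented by [volume]:
   ( *w)(v_1,..,v_4) = 1/2! sum_(i,j) w(E_i,E_j) vol(E_i,E_j,v_1,..,v_4) *)
Definition hodge2 (w : form (R := R) 5 2) : form 5 4 := fun x v =>
  2^-1 * \sum_i \sum_j w x (vec2 (E i x) (E j x)) *
    volume x (fun k : 'I_(2 + 4) => match fintype.split k with
      | inl a => vec2 (E i x) (E j x) a
      | inr b => v b end).

Definition nijenhuis (X Y : vfield (R := R) 5) : vfield 5 := fun x =>
  let JX y := cplx y (X y) in let JY y := cplx y (Y y) in
  bracket JX JY x - cplx x (bracket JX Y x) - cplx x (bracket X JY x)
  - bracket X Y x.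

Definition on_M (X : V -> V) : Prop := inv_vfield M (gamma M) X.

Record balanced_hermitian : Prop := BalancedHermitian {
  cplx_sqr : forall x v, cplx x (cplx x v) = - v;
  cplx_metric : forall x v w, metric x (cplx x v) (cplx x w) = metric x v w;
  cplx_integrable : forall X Y, on_M X -> on_M Y ->
    forall x, nijenhuis X Y x = 0;
  kaehler_coclosed : forall x v, extd (hodge2 kaehler) x v = 0 }.

(* [D x v Y] is the covariant derivative at x of the vector field Y in the
   direction v *)
Definition connection := V -> V -> vfield (R := R) 5 -> V.

Record is_connection (D : connection) : Prop := IsConnection {
  conn_linear : forall x c v w Y, on_M Y ->
    D x (c *: v + w) Y = c *: D x v Y + D x w Y;
  conn_add : forall x v Y Z, on_M Y -> on_M Z ->
    D x v (fun y => Y y + Z y) = D x v Y + D x v Z;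
  conn_leibniz : forall x v f Y, inv_function M (gamma M) f -> on_M Y ->
    D x v (fun y => f y *: Y y) = 'D_v f x *: Y x + f x *: D x v Y;
  conn_vfield : forall X Y, on_M X -> on_M Y -> on_M (fun x => D x (X x) Y) }.

Definition metric_connection (D : connection) : Prop :=
  forall x v Y Z, on_M Y -> on_M Z ->
  'D_v (fun y => metric y (Y y) (Z y)) x =
    metric x (D x v Y) (Z x) + metric x (Y x) (D x v Z).

Definition cplx_parallel (D : connection) : Prop :=
  forall x v Y, on_M Y -> D x v (fun y => cplx y (Y y)) = cplx x (D x v Y).

Record levi_civita (D : connection) : Prop := LeviCivita {
  lc_connection : is_connection D;
  lc_metric : metric_connection D;
  lc_torsion_free : forall X Y, on_M X -> on_M Y ->
    forall x, D x (X x) Y - D x (Y x) X = bracket X Y x }.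

(* the connection D' with g(D'_X Y, Z) = g(D_X Y, Z) + S(X, Y, Z) *)
Definition shift_connection (D : connection) (S : V -> V -> V -> V -> R) :
    connection :=
  fun x v Y => D x v Y + \sum_k S x v (Y x) (E k x) *: E k x.

Definition nabla_plus (D : connection) : connection :=
  shift_connection D (fun x u v w => 2^-1 * torsion x (vec3 u v w)).

Definition nabla_chern (D : connection) : connection :=
  shift_connection D (fun x u v w =>
    2^-1 * extd kaehler x (vec3 (cplx x u) v w)).

Definition conn_form (D : connection) (i j : 'I_6) : form 5 1 := fun x v =>
  metric x (D x (v ord0) (E j)) (E i x).

(* the connection with D_X E_j = sum_i sigma^i_j(X) E_i *)
Definition connection_of_forms (sigma : 'I_6 -> 'I_6 -> form (R := R) 5 1) :
    connection := fun x v Y =>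
  \sum_i ('D_v (fun y => co i y (Y y)) x
          + \sum_j sigma i j x (fun=> v) * co j x (Y x)) *: E i x.

Definition sigma (lambda mu : R) (i j : 'I_6) : form 5 1 := fun x v =>
  let a := lambda * coframe M (ix 1) x v + mu * coframe M (ix 6) x v in
  let upper (p q : nat) :=
    if (p, q) \in [:: (2, 3); (2, 5); (4, 5)]%N then - a else a in
  if (i < j)%N then upper i.+1 j.+1
  else if (j < i)%N then - upper j.+1 i.+1
  else 0.

Definition A_conn (lambda mu : R) : connection :=
  connection_of_forms (sigma lambda mu).

Definition curv_form (D : connection) (i j : 'I_6) : form 5 2 := fun x v =>
  extd (conn_form D i j) x v
  + \sum_k wedge (conn_form D i k) (conn_form D k j) x v.

Definition pontrjagin1 (D : connection) : form 5 4 := fun x v =>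
  (8 * pi ^+ 2)^-1 *
  \sum_(i < 6) \sum_(j < 6 | (i < j)%N)
    wedge (curv_form D i j) (curv_form D i j) x v.

(* R(v, w) u, with R(v, w) E_j = sum_i Omega^i_j(v, w) E_i *)
Definition curvature (D : connection) (x v w u : V) : V :=
  \sum_i \sum_j (curv_form D i j x (vec2 v w) * co j x u) *: E i x.

(* the last clause is the tracelessness which, for a connection preserving g
   and J, reduces the holonomy from U(3) to SU(3) *)
Record hol_su3 (D : connection) : Prop := HolSU3 {
  hol_metric : metric_connection D;
  hol_cplx : cplx_parallel D;
  hol_trace : forall x v w,
    \sum_i metric x (curvature D x v w (cplx x (E i x))) (E i x) = 0 }.

Record su3_instanton (D : connection) : Prop := SU3Instanton {
  inst_11 : forall i j x v w,
    curv_form D i j x (vec2 (cplx x v) (cplx x w)) =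
    curv_form D i j x (vec2 v w);
  inst_primitive : forall i j x,
    \sum_k curv_form D i j x (vec2 (E k x) (cplx x (E k x))) = 0 }.

(* heterotic supersymmetry equations with constant dilaton for (M, J, g, A),
   [D] being the Levi-Civita connection *)
Record heterotic_susy (D A : connection) : Prop := HeteroticSusy {
  susy_gravitino : hol_su3 (nabla_plus D);
  susy_dilatino : balanced_hermitian;
  susy_gaugino : su3_instanton A }.

Definition bianchi (D A : connection) : Prop :=
  exists2 alpha' : R, 0 < alpha' & forall x v,
    extd torsion x v =
    alpha' / 4 * (8 * pi ^+ 2) * (pontrjagin1 D x v - pontrjagin1 A x v).

End Geometry.

(* Main.v *)
Require Import Defs.
From HB Require Import structures.
From mathcomp Require Import all_boot all_order all_algebra all_fingroup.
From mathcomp Require Import all_classical all_reals all_analysis.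
From mathcomp Require Import ring lra.
Require Import Defs.

Set Implicit Arguments.
Unset Strict Implicit.
Unset Printing Implicit Defensive.

Import Order.TTheory GRing.Theory Num.Theory.
Import numFieldNormedType.Exports.
Local Open Scope ring_scope.

(** All the tensors of the theorem are left invariant, so it is an identity
    between constant tensors on the Lie algebra. The coordinates [crd x v] of a
    tangent vector in the coframe identify every tangent space with R^6, and
    each form is the pull-back along [crd] of a fixed alternating map. On such
    pull-backs the exterior derivative is the Chevalley-Eilenberg differential
    ([extd1], ..., [extd4]): antisymmetrising the derivatives of the coframe
    leaves only the structure equations ([dcrdC]).

    Koszul's formula [levi_civitaE] gives the connection forms of the
    Levi-Civita connection, hence those of the Bismut-Strominger and of the
    Chern connection, as skew matrices of constant one-forms ([plus_form] and
    [chern_form]). From these, writing e^{1234} for the exterior product of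
    e^1, ..., e^4,
      dT              =  - 8 e^{1234} -  8 e^{1256}      ([dtorsE])
      8 pi^2 p_1(+)   = - 48 e^{1234} - 16 e^{1256}      ([p1_plus])
      8 pi^2 p_1(c)   = - 16 e^{1234} - 16 e^{1256}      ([p1_chern]).
    The fifteen independent connection forms of A are plus or minus one and the
    same one-form theta = lambda e^1 + mu e^6. Their exterior products vanish,
    so that each curvature form is plus or minus d theta = 2 mu (e^{13} + e^{24}),
    whence 8 pi^2 p_1(A) = - 120 mu^2 e^{1234} ([p1_A]). As
    4 pi^2 = (8 pi^2) / 2, the two Bianchi identities amount to
    - 48 + 120 mu^2 = - 16, that is mu^2 = 4 / 15, and to
    - 16 + 120 mu^2 = - 16, that is mu = 0.

    For the supersymmetry equations: e^{13} + e^{24} is of type (1,1) and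
    primitive, so A is an instanton. The matrices [plus_form] are skew and
    commute with J, and the J-trace of their curvature vanishes; the Leibniz
    rule ([conn_coord]) carries this from the frame over to all vector fields on
    the quotient. That J is parallel for a connection with skew torsion also
    reduces its integrability to an algebraic property of the torsion
    ([nijenhuis_eq0]). The metric is balanced because *F is half the square of
    F ([hodge_kaehler]), and F /\ dF = 0 ([d_star_omega]). *)

(** * Smooth maps and the product rule *)

Section SmoothCalculus.
Context {R : realType}.

Section Generic.
Context {V W : normedModType R}.
Implicit Types f g : V -> W.

Lemma CkW k f : Ck k.+1 f -> Ck k f.
Proof.
elim: k f => [|k IH] f [df Df] /=.
  by move=> x; apply: differentiable_continuous; exact: df.
split=> [|v]; first exact: df.
by apply: (IH _ _); exact: Df.
Qed.

Lemma smooth_diff f x : smooth f -> differentiable f x.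
Proof. by move=> /(_ 1%N) []. Qed.

Lemma smooth_derivable f x v : smooth f -> derivable f x v.
Proof. by move=> sf; apply: diff_derivable; exact: smooth_diff. Qed.

Lemma Ck_cst k (w : W) : Ck k (fun _ : V => w).
Proof.
elim: k w => [|k IH] w /=; first exact: cst_continuous.
split=> [x|v]; first exact: differentiable_cst.
rewrite [X in Ck _ X](_ : _ = fun=> 0); first exact: IH.
by apply/funext => x; rewrite derive_cst.
Qed.

Lemma CkD k f g : Ck k f -> Ck k g -> Ck k (fun y => f y + g y).
Proof.
elim: k f g => [|k IH] f g /=.
  by move=> cf cg x; apply: cvgD; [exact: cf|exact: cg].
move=> [df Df] [dg Dg]; split=> [x|v]; first exact: differentiableD.
rewrite [X in Ck _ X](_ : _ = fun y => 'D_v f y + 'D_v g y).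
  by apply: IH.
by apply/funext => y; apply: deriveD; apply: diff_derivable.
Qed.

Lemma Ck_sum k n (F : 'I_n -> V -> W) :
  (forall i, Ck k (F i)) -> Ck k (fun y => \sum_i F i y).
Proof.
move=> sF; elim: n F sF => [|n IH] F sF.
  rewrite [X in Ck _ X](_ : _ = fun=> 0); first exact: Ck_cst.
  by apply/funext => y; rewrite big_ord0.
under eq_fun do rewrite big_ord_recl.
by apply: CkD => //; apply: IH.
Qed.

End Generic.

Lemma CkM {V : normedModType R} k (f g : V -> R) :
  Ck k f -> Ck k g -> Ck k (fun y => f y * g y).
Proof.
elim: k f g => [|k IH] f g.
  by move=> cf cg x; apply: cvgM; [exact: cf|exact: cg].
move=> sf sg; have [df Df] := sf; have [dg Dg] := sg.
split=> [x|v]; first exact: differentiableM.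
rewrite [X in Ck _ X](_ : _ = fun y => f y * 'D_v g y + g y * 'D_v f y).
  by apply: CkD; apply: IH; [exact: CkW sf|exact: Dg|exact: CkW sg|exact: Df].
by apply/funext => y; apply: deriveM; apply: diff_derivable.
Qed.

Section RowVector.
Context {V : normedModType R} {n : nat}.
Implicit Types X : V -> 'rV[R]_n.

Lemma rV_sum_coord X :
  X = \sum_j (fun y => X y 0 j *: delta_mx 0 j).
Proof.
by apply/funext => y; rewrite fct_sumE [LHS]row_sum_delta.
Qed.

Lemma Ck_coord k X j : Ck k X -> Ck k (fun y => X y 0 j).
Proof.
elim: k X => [|k IH] X /=.
  move=> cX x.
  exact: (continuous_comp (cX x) (@coord_continuous _ _ _ _ _ _)).
move=> [dX DX]; split=> [x|v].
  exact: (differentiable_comp (dX x) (@differentiable_coord _ _ _ _ _ _)).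
rewrite [X in Ck _ X](_ : _ = fun y => 'D_v X y 0 j); first exact: IH.
by apply/funext => y; rewrite derive_mx ?mxE//; exact: diff_derivable.
Qed.

(** Smoothness of vector fields is reduced to that of their coordinates, which
    are real functions and can be multiplied. *)
Lemma Ck_rV k X : (forall j, Ck k (fun y => X y 0 j)) -> Ck k X.
Proof.
elim: k X => [|k IH] X /= sX.
  rewrite (rV_sum_coord X) => x.
  elim/big_ind: _ => [|f g|j _]; first exact: cst_continuous.
    exact: continuousD.
  by apply: cvgZr_tmp; exact: sX.
have dX x : differentiable X x.
  rewrite (rV_sum_coord X); apply: differentiable_sum => j.
  by apply: differentiableZl; case: (sX j).
split=> // v; apply: IH => j.
rewrite [X in Ck _ X](_ : _ = 'D_v (fun y => X y 0 j)); first by case: (sX j).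
by apply/funext => y; rewrite derive_mx ?mxE//; exact: diff_derivable.
Qed.

Lemma CkZ k (f : V -> R) X :
  Ck k f -> Ck k X -> Ck k (fun y => f y *: X y).
Proof.
move=> sf sX; apply: Ck_rV => j.
under eq_fun do rewrite mxE.
by apply: CkM => //; exact: Ck_coord.
Qed.

End RowVector.

Section LinearForm.
Context {U : lmodType R} (L : U -> R).
Hypothesis linL : forall c u w, L (c *: u + w) = c * L u + L w.

Lemma linear_form0 : L 0 = 0.
Proof.
have := linL 1 0 0; rewrite scale1r add0r mul1r => /eqP.
by rewrite -subr_eq0 opprD addNKr oppr_eq0 => /eqP.
Qed.

Lemma linear_form_sum (I : finType) (c : I -> R) (w : I -> U) :
  L (\sum_i c i *: w i) = \sum_i c i * L (w i).
Proof.
elim/big_ind2: _ => [|u1 r1 u2 r2 <- <-|i _]; first exact: linear_form0.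
  by rewrite -[X in X + _]scale1r linL mul1r.
by rewrite -[_ *: _]addr0 linL linear_form0 addr0.
Qed.

End LinearForm.

(** The product rule for the pairing of a varying linear form with a varying
    vector; applied to one slot after the other, it differentiates every
    multilinear expression. *)
Lemma is_derive_pairing {V : normedModType R} {n : nat}
    (L : V -> 'rV[R]_n -> R) (a : V -> 'rV[R]_n) x v dL da :
    (forall y c u w, L y (c *: u + w) = c * L y u + L y w) ->
    (forall u, is_derive x v (L^~ u) (dL u)) -> is_derive x v a da ->
  is_derive x v (fun y => L y (a y)) (dL (a x) + L x da).
Proof.
move=> Llin HL Ha.
have Lsum y u : L y u = \sum_j u 0 j * L y (delta_mx 0 j).
  by rewrite {1}[u]row_sum_delta; exact: linear_form_sum.
have dLsum u : dL u = \sum_j u 0 j * dL (delta_mx 0 j).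
  rewrite -(@derive_val _ _ _ _ _ _ _ (HL u)).
  rewrite (_ : L^~ u = \sum_j (fun y => u 0 j *: L y (delta_mx 0 j))).
    rewrite derive_sum => [|j]; last exact: derivableZ.
    by apply: eq_bigr => j _; rewrite deriveZ // derive_val.
  by apply/funext => y; rewrite fct_sumE Lsum.
rewrite (_ : (fun y => _) =
    \sum_j ((fun y => a y 0 j) * (fun y => L y (delta_mx 0 j)))); last first.
  by apply/funext => y; rewrite fct_sumE Lsum.
have Haj j : is_derive x v (fun y => a y 0 j) (da 0 j).
  have Da : derivable a x v by [].
  apply: DeriveDef; first by move/derivable_mxP : Da.
  by rewrite -(@derive_val _ _ _ _ _ _ _ Ha) derive_mx // mxE.
have Hj j := is_deriveM (Haj j) (HL (delta_mx 0 j)).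
apply: is_derive_eq (is_derive_sum Hj) _.
rewrite dLsum Lsum -big_split /=; apply: eq_bigr => j _.
by congr (_ + _); rewrite mulrC.
Qed.

End SmoothCalculus.

(** * Exterior products of forms of degree one and two *)

Section PermSum.

(** Laplace expansion for arbitrary sums over permutations: a permutation of
    [n.+1] points is the image of the first point and a permutation of the
    others. Iterated, it lists the permutations of four slots. *)
Lemma sum_perm_lift (A : nmodType) n (F : 'S_n.+1 -> A) :
  \sum_s F s = \sum_(j < n.+1) \sum_(t : 'S_n) F (lift_perm ord0 j t).
Proof.
rewrite pair_big /=.
apply: (reindex (fun p : 'I_n.+1 * 'S_n => lift_perm ord0 p.1 p.2)).
apply: onW_bij; apply: inj_card_bij; last first.
  by rewrite card_prod !card_Sn card_ord factS.
move=> [j t] [j' t'] /= /permP E.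
have Ej : j = j' by have := E ord0; rewrite !lift_perm_id.
rewrite {j}Ej in E *; congr (_, _); apply/permP => k.
by have := E (lift ord0 k); rewrite !lift_perm_lift => /lift_inj.
Qed.

Lemma sum_perm0 (A : nmodType) (F : 'S_0 -> A) : \sum_s F s = F 1%g.
Proof.
rewrite (bigD1 1%g) //= big1 ?addr0 // => s /eqP; case.
by apply/permP => -[].
Qed.

Lemma signr_lift_perm (A : pzRingType) n (j : 'I_n.+1) (t : 'S_n) :
  (-1) ^+ lift_perm ord0 j t = (-1) ^+ j * (-1) ^+ t :> A.
Proof. by rewrite odd_lift_perm /= signr_addb signr_odd. Qed.

End PermSum.

Section Wedge.
Context {R : realType}.
Local Notation V := 'rV[R]_6.

Lemma alt_sum2 (K : nat -> nat -> R) :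
  \sum_(s : 'S_2) (-1) ^+ s * K (s ord0) (s (lift ord0 ord0)) = K 0 1 - K 1 0.
Proof.
rewrite sum_perm_lift.
under eq_bigr => j _.
  rewrite sum_perm_lift.
  under eq_bigr => k _.
    rewrite sum_perm0 !signr_lift_perm odd_perm1 !lift_perm_id lift_perm_lift.
    rewrite lift_perm_id.
    over.
  over.
rewrite !big_ord_recl !big_ord0.
rewrite /= /bump /=; ring.
Qed.

Lemma alt_sum4 (K : nat -> nat -> nat -> nat -> R) :
  \sum_(s : 'S_4) (-1) ^+ s * K (s ord0) (s (lift ord0 ord0))
     (s (lift ord0 (lift ord0 ord0)))
     (s (lift ord0 (lift ord0 (lift ord0 ord0)))) =
  (K 0 1 2 3 - K 0 1 3 2 - K 0 2 1 3 + K 0 2 3 1 + K 0 3 1 2 - K 0 3 2 1)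
  - (K 1 0 2 3 - K 1 0 3 2 - K 1 2 0 3 + K 1 2 3 0 + K 1 3 0 2 - K 1 3 2 0)
  + (K 2 0 1 3 - K 2 0 3 1 - K 2 1 0 3 + K 2 1 3 0 + K 2 3 0 1 - K 2 3 1 0)
  - (K 3 0 1 2 - K 3 0 2 1 - K 3 1 0 2 + K 3 1 2 0 + K 3 2 0 1 - K 3 2 1 0).
Proof.
rewrite sum_perm_lift.
under eq_bigr => j _.
  rewrite sum_perm_lift.
  under eq_bigr => k _.
    rewrite sum_perm_lift.
    under eq_bigr => l _.
      rewrite sum_perm_lift.
      under eq_bigr => m _.
        rewrite sum_perm0 !signr_lift_perm odd_perm1.
        rewrite !(lift_perm_id, lift_perm_lift).
        over.
      over.
    over.
  over.
rewrite !big_ord_recl !big_ord0.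
rewrite /= /bump /=; ring.
Qed.

Lemma wedge11 (a b : form (R := R) 5 1) x v :
  wedge a b x v = a x (fun=> v (inord 0)) * b x (fun=> v (inord 1)) -
                  a x (fun=> v (inord 1)) * b x (fun=> v (inord 0)).
Proof.
have aE (c : form 5 1) (f : 'I_1 -> V) : c x f = c x (fun=> f ord0).
  by congr (c x _); apply/funext => i; rewrite (ord1 i).
have vE i : v i = v (inord i) by rewrite inord_val.
pose K i j := a x (fun=> v (inord i)) * b x (fun=> v (inord j)).
rewrite -[RHS](alt_sum2 K) /wedge invr1 mul1r; apply: eq_bigr => s _.
rewrite -mulrA aE (aE b) /K !inord_val.
by congr (_ * (a x _ * b x _)); apply/funext => _; congr (v (s _));
  apply: val_inj.
Qed.

(** The exterior product of two two-forms has the six terms of the shuffles of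
    four slots; the remaining permutations repeat them four times. *)
Lemma wedge22 (a b : form (R := R) 5 2) (A B : V -> V -> R) x v :
  (forall w, a x w = A (w (inord 0)) (w (inord 1))) ->
  (forall w, b x w = B (w (inord 0)) (w (inord 1))) ->
  (forall u w, A u w = - A w u) -> (forall u w, B u w = - B w u) ->
  let v' := fun k => v (inord k) in
  wedge a b x v =
    A (v' 0) (v' 1) * B (v' 2) (v' 3) - A (v' 0) (v' 2) * B (v' 1) (v' 3)
    + A (v' 0) (v' 3) * B (v' 1) (v' 2) + A (v' 1) (v' 2) * B (v' 0) (v' 3)
    - A (v' 1) (v' 3) * B (v' 0) (v' 2) + A (v' 2) (v' 3) * B (v' 0) (v' 1).
Proof.
move=> aE bE Askew Bskew v'.
have vE i : v i = v' i by rewrite /v' inord_val.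
rewrite /wedge.
transitivity (4^-1 * \sum_(s : 'S_4) (-1) ^+ s *
   (fun i j k l => A (v' i) (v' j) * B (v' k) (v' l))
     (s ord0) (s (lift ord0 ord0)) (s (lift ord0 (lift ord0 ord0)))
     (s (lift ord0 (lift ord0 (lift ord0 ord0))))).
  congr (_ * _); apply: eq_bigr => s _.
  rewrite aE bE !vE /= [in RHS]mulrA.
  have slot (i j : 'I_4) : i = j :> nat -> v' (s i) = v' (s j).
    by move=> /ord_inj ->.
  by congr (_ * A _ _ * B _ _); apply: slot; rewrite /= inordK.
rewrite (alt_sum4 (fun i j k l => A (v' i) (v' j) * B (v' k) (v' l))) /=.
rewrite (Askew (v' 1) (v' 0)) (Askew (v' 2) (v' 0)) (Askew (v' 3) (v' 0)).
rewrite (Askew (v' 2) (v' 1)) (Askew (v' 3) (v' 1)) (Askew (v' 3) (v' 2)).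
rewrite (Bskew (v' 1) (v' 0)) (Bskew (v' 2) (v' 0)) (Bskew (v' 3) (v' 0)).
rewrite (Bskew (v' 2) (v' 1)) (Bskew (v' 3) (v' 1)) (Bskew (v' 3) (v' 2)).
by field.
Qed.

End Wedge.

(** * Derivatives of alternating maps of varying vectors *)

Section Alternating.
Context {R : realType} {n : nat}.
Local Notation U := 'rV[R]_n.

(** Alternating forms. Linearity is required in one slot only; the sign rule
    carries it to the others. *)
Definition alt2 (W : U -> U -> R) : Prop :=
  (forall c u u' v, W (c *: u + u') v = c * W u v + W u' v) /\
  (forall u v, W u v = - W v u).

Definition alt3 (W : U -> U -> U -> R) : Prop :=
  (forall u, alt2 (W u)) /\ (forall u v w, W u v w = - W v u w).

Definition alt4 (W : U -> U -> U -> U -> R) : Prop :=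
  (forall u, alt3 (W u)) /\ (forall u v w z, W u v w z = - W v u w z).

Lemma alt2_linr W c u v v' : alt2 W -> W u (c *: v + v') = c * W u v + W u v'.
Proof. by case=> lW sW; rewrite sW lW !(sW u); ring. Qed.

(** Fixing the last argument, which is what the iterated product rule does. *)
Lemma alt3_fix W w : alt3 W -> alt2 (fun u v => W u v w).
Proof.
case=> aW sW; split=> // c u u' v; have [lWv _] := aW v.
by rewrite sW lWv (sW u) (sW u'); ring.
Qed.

Lemma alt3_linr W c u v w w' : alt3 W ->
  W u v (c *: w + w') = c * W u v w + W u v w'.
Proof. by case=> aW _; exact: alt2_linr. Qed.

Lemma alt4_fix W z : alt4 W -> alt3 (fun u v w => W u v w z).
Proof.
by case=> aW sW; split=> // u; apply: alt3_fix; exact: aW.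
Qed.

Lemma alt4_linr W c u v w z z' : alt4 W ->
  W u v w (c *: z + z') = c * W u v w z + W u v w z'.
Proof. by case=> aW _; exact: alt3_linr. Qed.

Context {V : normedModType R} (x h : V).

Lemma is_derive_lin1 (L : U -> R) (a : V -> U) da :
  (forall c u u', L (c *: u + u') = c * L u + L u') ->
  is_derive x h a da -> is_derive x h (fun y => L (a y)) (L da).
Proof.
move=> lL Ha; apply: is_derive_eq.
  apply: (@is_derive_pairing _ _ _ (fun=> L) _ _ _ (fun=> 0) da) => //.
  by move=> u; exact: is_derive_cst.
by rewrite /= add0r.
Qed.

Lemma is_derive_alt2 W (a b : V -> U) da db : alt2 W ->
  is_derive x h a da -> is_derive x h b db ->
  is_derive x h (fun y => W (a y) (b y)) (W da (b x) + W (a x) db).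
Proof.
move=> aW Ha Hb.
apply: (@is_derive_pairing _ _ _ (fun y => W (a y)) _ _ _ (W da)) => //.
  by move=> *; exact: alt2_linr.
move=> u; apply: (is_derive_lin1 (L := W^~ u)) => // *.
by case: aW => lW _; rewrite lW.
Qed.

Lemma is_derive_alt3 W (a b c : V -> U) da db dc : alt3 W ->
  is_derive x h a da -> is_derive x h b db -> is_derive x h c dc ->
  is_derive x h (fun y => W (a y) (b y) (c y))
    (W da (b x) (c x) + W (a x) db (c x) + W (a x) (b x) dc).
Proof.
move=> aW Ha Hb Hc.
apply: (@is_derive_pairing _ _ _ (fun y => W (a y) (b y)) _ _ _
  (fun w => W da (b x) w + W (a x) db w)) => //.
  by move=> *; exact: alt3_linr.
by move=> w; exact: (is_derive_alt2 (alt3_fix w aW)).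
Qed.

Lemma is_derive_alt4 W (a b c d : V -> U) da db dc dd : alt4 W ->
  is_derive x h a da -> is_derive x h b db -> is_derive x h c dc ->
  is_derive x h d dd ->
  is_derive x h (fun y => W (a y) (b y) (c y) (d y))
    (W da (b x) (c x) (d x) + W (a x) db (c x) (d x)
     + W (a x) (b x) dc (d x) + W (a x) (b x) (c x) dd).
Proof.
move=> aW Ha Hb Hc Hd.
apply: (@is_derive_pairing _ _ _ (fun y => W (a y) (b y) (c y)) _ _ _
  (fun z => W da (b x) (c x) z + W (a x) db (c x) z
     + W (a x) (b x) dc z)) => //.
  by move=> *; exact: alt4_linr.
by move=> z; exact: (is_derive_alt3 (alt4_fix z aW)).
Qed.

End Alternating.

Section Antisymmetrisation.
Context {R : realType} {n : nat}.
Local Notation U := 'rV[R]_n.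
(* [D i j] will be the derivative in the direction of the i-th argument of the
   coordinates of the j-th one, and [u j] these coordinates. The left-hand sides
   below are then the alternating sums defining the exterior derivative, in
   which the terms in [D i j] and [D j i] only leave their difference. *)
Context (D C : nat -> nat -> U) (u : nat -> U).
Hypothesis DC : forall i j, D i j = 1 *: C i j + D j i.

Lemma antisym_alt2 W : alt2 W ->
  W (D 0 1) (u 2) + W (u 1) (D 0 2) - (W (D 1 0) (u 2) + W (u 0) (D 1 2))
  + (W (D 2 0) (u 1) + W (u 0) (D 2 1)) =
  W (C 0 1) (u 2) - W (C 0 2) (u 1) + W (C 1 2) (u 0).
Proof.
move=> [lW sW].
have flip1 a i j : W a (D i j) = - W (D i j) a by exact: sW.
by rewrite !flip1 (DC 0 1) (DC 0 2) (DC 1 2) !lW; ring.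
Qed.

Lemma antisym_alt3 W : alt3 W ->
  W (D 0 1) (u 2) (u 3) + W (u 1) (D 0 2) (u 3) + W (u 1) (u 2) (D 0 3)
  - (W (D 1 0) (u 2) (u 3) + W (u 0) (D 1 2) (u 3) + W (u 0) (u 2) (D 1 3))
  + (W (D 2 0) (u 1) (u 3) + W (u 0) (D 2 1) (u 3) + W (u 0) (u 1) (D 2 3))
  - (W (D 3 0) (u 1) (u 2) + W (u 0) (D 3 1) (u 2) + W (u 0) (u 1) (D 3 2)) =
  W (C 0 1) (u 2) (u 3) - W (C 0 2) (u 1) (u 3) + W (C 0 3) (u 1) (u 2)
  + W (C 1 2) (u 0) (u 3) - W (C 1 3) (u 0) (u 2) + W (C 2 3) (u 0) (u 1).
Proof.
move=> aW; have [aWu sW] := aW.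
have lW c a a' b d : W (c *: a + a') b d = c * W a b d + W a' b d.
  by have [lW' _] := alt3_fix d aW; rewrite lW'.
have flip1 a i j b : W a (D i j) b = - W (D i j) a b by exact: sW.
have flip2 a b i j : W a b (D i j) = W (D i j) a b.
  by have [_ s2] := aWu a; rewrite s2 flip1 opprK.
rewrite !flip1 !flip2 (DC 0 1) (DC 0 2) (DC 0 3) (DC 1 2) (DC 1 3) (DC 2 3) !lW.
by ring.
Qed.

Lemma antisym_alt4 W : alt4 W ->
  W (D 0 1) (u 2) (u 3) (u 4) + W (u 1) (D 0 2) (u 3) (u 4)
  + W (u 1) (u 2) (D 0 3) (u 4) + W (u 1) (u 2) (u 3) (D 0 4)
  - (W (D 1 0) (u 2) (u 3) (u 4) + W (u 0) (D 1 2) (u 3) (u 4)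
     + W (u 0) (u 2) (D 1 3) (u 4) + W (u 0) (u 2) (u 3) (D 1 4))
  + (W (D 2 0) (u 1) (u 3) (u 4) + W (u 0) (D 2 1) (u 3) (u 4)
     + W (u 0) (u 1) (D 2 3) (u 4) + W (u 0) (u 1) (u 3) (D 2 4))
  - (W (D 3 0) (u 1) (u 2) (u 4) + W (u 0) (D 3 1) (u 2) (u 4)
     + W (u 0) (u 1) (D 3 2) (u 4) + W (u 0) (u 1) (u 2) (D 3 4))
  + (W (D 4 0) (u 1) (u 2) (u 3) + W (u 0) (D 4 1) (u 2) (u 3)
     + W (u 0) (u 1) (D 4 2) (u 3) + W (u 0) (u 1) (u 2) (D 4 3)) =
  W (C 0 1) (u 2) (u 3) (u 4) - W (C 0 2) (u 1) (u 3) (u 4)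
  + W (C 0 3) (u 1) (u 2) (u 4) - W (C 0 4) (u 1) (u 2) (u 3)
  + W (C 1 2) (u 0) (u 3) (u 4) - W (C 1 3) (u 0) (u 2) (u 4)
  + W (C 1 4) (u 0) (u 2) (u 3) + W (C 2 3) (u 0) (u 1) (u 4)
  - W (C 2 4) (u 0) (u 1) (u 3) + W (C 3 4) (u 0) (u 1) (u 2).
Proof.
move=> aW; have [aWu sW] := aW.
have lW c a a' b d e : W (c *: a + a') b d e = c * W a b d e + W a' b d e.
  by have [lW' _] := alt3_fix d (alt4_fix e aW); rewrite lW'.
have flip1 a i j b d : W a (D i j) b d = - W (D i j) a b d by exact: sW.
have flip2 a b i j d : W a b (D i j) d = W (D i j) a b d.
  by have [_ s2] := aWu a; rewrite s2 flip1 opprK.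
have flip3 a b d i j : W a b d (D i j) = - W (D i j) a b d.
  by have [aWab _] := aWu a; have [_ s3] := aWab b; rewrite s3 flip2.
rewrite !flip1 !flip2 !flip3 (DC 0 1) (DC 0 2) (DC 0 3) (DC 0 4).
rewrite (DC 1 2) (DC 1 3) (DC 1 4) (DC 2 3) (DC 2 4) (DC 3 4) !lW.
by ring.
Qed.

End Antisymmetrisation.

(** * The exterior derivative of invariant forms *)

Lemma all_ix (P : 'I_6 -> Prop) :
  P (ix 1) -> P (ix 2) -> P (ix 3) -> P (ix 4) -> P (ix 5) -> P (ix 6) ->
  forall i, P i.
Proof.
move=> P1 P2 P3 P4 P5 P6 i; rewrite -(inord_val i).
by case: i => -[|[|[|[|[|[|]]]]]] //=.
Qed.

Lemma sum_ix (A : nmodType) (F : 'I_6 -> A) :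
  \sum_i F i = F (ix 1) + F (ix 2) + F (ix 3) + F (ix 4) + F (ix 5) + F (ix 6).
Proof.
pose f k := F (inord k).
transitivity (\sum_(i < 6) f i).
  by apply: eq_bigr => i _; rewrite /f inord_val.
by rewrite !big_ord_recl big_ord0 addr0 !addrA.
Qed.

Lemma val_ix k : (0 < k <= 6)%N -> ix k = k.-1 :> nat.
Proof. by case: k => // k /= k6; rewrite inordK. Qed.

Lemma eq_ix j k : (0 < j <= 6)%N -> (0 < k <= 6)%N -> (ix j == ix k) = (j == k).
Proof.
by move=> hj hk; rewrite -val_eqE /= !val_ix //; case: j k hj hk => [|j] [|k].
Qed.

Section Coordinates.
Context {R : realType} (M : h19_nilmanifold R).
Local Notation V := 'rV[R]_6.
Local Notation E := (frame M).

Definition crd (x v : V) : V := \row_i co M i x v.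

Definition bvec k : V := delta_mx 0 (ix k).

(** The coordinates of [dstr u v] are the values of d e^1, ..., d e^6 on the
    vectors u and v. On invariant fields e^k([X, Y]) = - d e^k(X, Y), so this is
    the opposite of the Lie bracket. It is locked so that rewriting with the
    coordinates of one vector never unfolds another. *)
Definition dstr (u v : V) : V := locked (
  2 *: ((u 0 (ix 1) * v 0 (ix 5) - u 0 (ix 5) * v 0 (ix 1)) *: bvec 3
      + (u 0 (ix 2) * v 0 (ix 5) - u 0 (ix 5) * v 0 (ix 2)) *: bvec 4
      + (u 0 (ix 1) * v 0 (ix 3) - u 0 (ix 3) * v 0 (ix 1)
       + u 0 (ix 2) * v 0 (ix 4) - u 0 (ix 4) * v 0 (ix 2)) *: bvec 6)).

Lemma coframeE i x v : coframe M i x v = co M i x (v ord0).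
Proof. by congr (coframe M i x _); apply/funext => k; rewrite (ord1 k). Qed.

Lemma co_linear i x c u v : co M i x (c *: u + v) = c * co M i x u + co M i x v.
Proof.
have eta w : [eta (fun=> 0 : V) with (ord0 : 'I_1) |-> w] = (fun=> w) :> (_ -> _).
  by apply/funext => k; rewrite (ord1 k) /=.
by have := invform_linear (coframe_inv M i) x (fun=> 0) ord0 c u v; rewrite !eta.
Qed.

Lemma crd_linear x c u v : crd x (c *: u + v) = c *: crd x u + crd x v.
Proof. by apply/rowP => i; rewrite !mxE co_linear. Qed.

Lemma crd_is_linear x : linear (crd x).
Proof. by move=> c u v; exact: crd_linear. Qed.

HB.instance Definition _ x :=
  GRing.isLinear.Build R V V _ (crd x) (crd_is_linear x).

Lemma crd_frame x k : crd x (E k x) = delta_mx 0 k.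
Proof. by apply/rowP => i; rewrite !mxE /co dual_frame. Qed.

Lemma crd_frame_sum x (c : V) : crd x (\sum_i c 0 i *: E i x) = c.
Proof.
rewrite linear_sum [RHS]row_sum_delta; apply: eq_bigr => i _.
by rewrite linearZ /= crd_frame.
Qed.

Lemma crd_comb x (c : 'I_6 -> R) i : crd x (\sum_k c k *: E k x) 0 i = c i.
Proof.
pose r : V := \row_k c k; transitivity (r 0 i); last by rewrite mxE.
rewrite -(crd_frame_sum x r); congr (crd x _ 0 i).
by apply: eq_bigr => k _; rewrite mxE.
Qed.

(** The matrix of the coframe is inverse to that of the frame on one side, hence
    on the other. *)
Lemma frame_crd x v : v = \sum_i crd x v 0 i *: E i x.
Proof.
pose A : 'M[R]_6 := lin1_mx (crd x); pose B : 'M[R]_6 := \matrix_i E i x.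
have cE u : crd x u = u *m A by rewrite mul_rV_lin1.
have BE (c : V) : \sum_i c 0 i *: E i x = c *m B.
  by rewrite mulmx_sum_row; apply: eq_bigr => i _; rewrite rowK.
have BA : B *m A = 1%:M.
  by apply/row_matrixP => i; rewrite row_mul rowK -cE crd_frame row1.
by rewrite BE cE -mulmxA (mulmx1C BA) mulmx1.
Qed.

Lemma crd_inj x : injective (crd x).
Proof. by move=> u v Euv; rewrite (frame_crd x u) Euv -frame_crd. Qed.

Lemma smooth_co i v : smooth (fun y => co M i y v).
Proof. exact: (invform_smooth (coframe_inv M i)). Qed.

Definition dcrd x h v := 'D_h (fun y => crd y v) x.

Lemma is_derive_crd x h v : is_derive x h (fun y => crd y v) (dcrd x h v).
Proof.
apply: derivableP; apply/derivable_mxP => i j; rewrite (ord1 i).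
under eq_fun do rewrite mxE.
exact: smooth_derivable (smooth_co _ _).
Qed.

Lemma lift_slot T k (v : 'I_k.+2 -> T) (i : 'I_k.+2) j :
  (j <= k)%N -> v (lift i (inord j)) = v (inord (bump i j)).
Proof.
move=> jk; congr v; apply: val_inj; rewrite /= !inordK //.
by rewrite /bump; case: (i <= j)%N; rewrite ?add1n ?add0n ?ltnS ?(leq_trans jk).
Qed.

Lemma extd_co i x (v : 'I_2 -> V) :
  extd (coframe M i) x v =
  dcrd x (v (inord 0)) (v (inord 1)) 0 i - dcrd x (v (inord 1)) (v (inord 0)) 0 i.
Proof.
have dE h w : 'D_h (fun y => co M i y w) x = dcrd x h w 0 i.
  rewrite /dcrd derive_mx; last by have := is_derive_crd x h w.
  by rewrite mxE; congr ('D_h _ x); apply/funext => y; rewrite mxE.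
have termE (k : 'I_2) :
    'D_(v k) (fun y => coframe M i y (fun j => v (lift k j))) x =
    dcrd x (v (inord k)) (v (inord (bump k 0))) 0 i.
  rewrite -dE inord_val; congr ('D_ _ _ x); apply/funext => y.
  by rewrite coframeE -[ord0]inord_val lift_slot.
by rewrite /extd !big_ord_recl big_ord0 !termE /= /bump /=; ring.
Qed.

(** The structure equations, in the form in which they enter the exterior
    derivative: the derivative of the coordinates of a fixed vector is
    symmetric up to them. *)
Lemma dcrdC x u v : dcrd x u v = dcrd x v u + dstr (crd x u) (crd x v).
Proof.
pose w : 'I_2 -> V := fun k => if k == ord0 then u else v.
have w0 : w (inord 0) = u by rewrite /w -val_eqE /= inordK.
have w1 : w (inord 1) = v by rewrite /w -val_eqE /= inordK.
apply/rowP => i; rewrite mxE addrC; apply/eqP; rewrite -subr_eq; apply/eqP.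
have := extd_co i x w; rewrite w0 w1 => <-.
move: i; apply: all_ix;
  rewrite ?(d_e1, d_e2, d_e3, d_e4, d_e5, d_e6) ?wedge11 ?coframeE
    ?w0 ?w1 /dstr -lock /bvec !mxE !eq_ix //=; ring.
Qed.

(** The Chevalley-Eilenberg formulas for the exterior derivative of the
    pull-back of a constant alternating map, in degrees 1 to 4. *)
Lemma extd1 (w : form (R := R) 5 1) (L : V -> R) x v :
  (forall y u, w y u = L (crd y (u (inord 0)))) ->
  (forall c u u', L (c *: u + u') = c * L u + L u') ->
  extd w x v = L (dstr (crd x (v (inord 0))) (crd x (v (inord 1)))).
Proof.
move=> wE lL.
pose D i j := dcrd x (v (inord i)) (v (inord j)).
have termE (k : 'I_2) :
    'D_(v k) (fun y => w y (fun j => v (lift k j))) x = L (D k (bump k 0)).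
  rewrite /D inord_val.
  have -> : (fun y => w y (fun j => v (lift k j))) =
      fun y => L (crd y (v (inord (bump k 0)))).
    by apply/funext => y; rewrite wE lift_slot.
  have H := is_derive_lin1 lL (is_derive_crd x (v k) (v (inord (bump k 0)))).
  by rewrite derive_val.
rewrite /extd !big_ord_recl big_ord0 !termE /= /bump /= !(add0n, add1n, addn0).
have -> : D 0%N 1%N =
    1 *: dstr (crd x (v (inord 0))) (crd x (v (inord 1))) + D 1%N 0%N.
  by rewrite scale1r addrC; exact: dcrdC.
by rewrite lL; ring.
Qed.

Lemma extd2 (w : form (R := R) 5 2) (W : V -> V -> R) x v :
  (forall y u, w y u = W (crd y (u (inord 0))) (crd y (u (inord 1)))) ->
  alt2 W ->
  let u k := crd x (v (inord k)) in
  extd w x v = W (dstr (u 0%N) (u 1%N)) (u 2%N) - W (dstr (u 0%N) (u 2%N)) (u 1%N)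
    + W (dstr (u 1%N) (u 2%N)) (u 0%N).
Proof.
move=> wE aW u.
pose D i j := dcrd x (v (inord i)) (v (inord j)).
have termE (k : 'I_3) :
    'D_(v k) (fun y => w y (fun j => v (lift k j))) x =
    W (D k (bump k 0)) (u (bump k 1)) + W (u (bump k 0)) (D k (bump k 1)).
  rewrite /D inord_val.
  have -> : (fun y => w y (fun j => v (lift k j))) =
      fun y => W (crd y (v (inord (bump k 0)))) (crd y (v (inord (bump k 1)))).
    by apply/funext => y; rewrite wE !lift_slot.
  have H := is_derive_alt2 aW (is_derive_crd x (v k) (v (inord (bump k 0))))
    (is_derive_crd x (v k) (v (inord (bump k 1)))).
  by rewrite derive_val.
have DC i j : D i j = 1 *: dstr (u i) (u j) + D j i.
  by rewrite scale1r addrC; exact: dcrdC.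
rewrite -(antisym_alt2 u DC aW) /extd !big_ord_recl big_ord0 !termE.
(* keeps [ring] from unfolding the derivatives *)
clear wE DC termE; clearbody D u.
by rewrite /= /bump /=; ring.
Qed.

Lemma extd3 (w : form (R := R) 5 3) (W : V -> V -> V -> R) x v :
  (forall y u, w y u = W (crd y (u (inord 0))) (crd y (u (inord 1)))
     (crd y (u (inord 2)))) ->
  alt3 W ->
  let u k := crd x (v (inord k)) in
  extd w x v =
    W (dstr (u 0%N) (u 1%N)) (u 2%N) (u 3%N)
    - W (dstr (u 0%N) (u 2%N)) (u 1%N) (u 3%N)
    + W (dstr (u 0%N) (u 3%N)) (u 1%N) (u 2%N)
    + W (dstr (u 1%N) (u 2%N)) (u 0%N) (u 3%N)
    - W (dstr (u 1%N) (u 3%N)) (u 0%N) (u 2%N)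
    + W (dstr (u 2%N) (u 3%N)) (u 0%N) (u 1%N).
Proof.
move=> wE aW u.
pose D i j := dcrd x (v (inord i)) (v (inord j)).
have termE (k : 'I_4) :
    'D_(v k) (fun y => w y (fun j => v (lift k j))) x =
    W (D k (bump k 0)) (u (bump k 1)) (u (bump k 2))
    + W (u (bump k 0)) (D k (bump k 1)) (u (bump k 2))
    + W (u (bump k 0)) (u (bump k 1)) (D k (bump k 2)).
  rewrite /D inord_val.
  have -> : (fun y => w y (fun j => v (lift k j))) =
      fun y => W (crd y (v (inord (bump k 0)))) (crd y (v (inord (bump k 1))))
        (crd y (v (inord (bump k 2)))).
    by apply/funext => y; rewrite wE !lift_slot.
  have H := is_derive_alt3 aW (is_derive_crd x (v k) (v (inord (bump k 0))))
    (is_derive_crd x (v k) (v (inord (bump k 1))))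
    (is_derive_crd x (v k) (v (inord (bump k 2)))).
  by rewrite derive_val.
have DC i j : D i j = 1 *: dstr (u i) (u j) + D j i.
  by rewrite scale1r addrC; exact: dcrdC.
rewrite -(antisym_alt3 u DC aW) /extd !big_ord_recl big_ord0 !termE.
clear wE DC termE; clearbody D u.
by rewrite /= /bump /=; ring.
Qed.

Lemma extd4 (w : form (R := R) 5 4) (W : V -> V -> V -> V -> R) x v :
  (forall y u, w y u = W (crd y (u (inord 0))) (crd y (u (inord 1)))
     (crd y (u (inord 2))) (crd y (u (inord 3)))) ->
  alt4 W ->
  let u k := crd x (v (inord k)) in
  extd w x v =
    W (dstr (u 0%N) (u 1%N)) (u 2%N) (u 3%N) (u 4%N)
    - W (dstr (u 0%N) (u 2%N)) (u 1%N) (u 3%N) (u 4%N)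
    + W (dstr (u 0%N) (u 3%N)) (u 1%N) (u 2%N) (u 4%N)
    - W (dstr (u 0%N) (u 4%N)) (u 1%N) (u 2%N) (u 3%N)
    + W (dstr (u 1%N) (u 2%N)) (u 0%N) (u 3%N) (u 4%N)
    - W (dstr (u 1%N) (u 3%N)) (u 0%N) (u 2%N) (u 4%N)
    + W (dstr (u 1%N) (u 4%N)) (u 0%N) (u 2%N) (u 3%N)
    + W (dstr (u 2%N) (u 3%N)) (u 0%N) (u 1%N) (u 4%N)
    - W (dstr (u 2%N) (u 4%N)) (u 0%N) (u 1%N) (u 3%N)
    + W (dstr (u 3%N) (u 4%N)) (u 0%N) (u 1%N) (u 2%N).
Proof.
move=> wE aW u.
pose D i j := dcrd x (v (inord i)) (v (inord j)).
have termE (k : 'I_5) :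
    'D_(v k) (fun y => w y (fun j => v (lift k j))) x =
    W (D k (bump k 0)) (u (bump k 1)) (u (bump k 2)) (u (bump k 3))
    + W (u (bump k 0)) (D k (bump k 1)) (u (bump k 2)) (u (bump k 3))
    + W (u (bump k 0)) (u (bump k 1)) (D k (bump k 2)) (u (bump k 3))
    + W (u (bump k 0)) (u (bump k 1)) (u (bump k 2)) (D k (bump k 3)).
  rewrite /D inord_val.
  have -> : (fun y => w y (fun j => v (lift k j))) =
      fun y => W (crd y (v (inord (bump k 0)))) (crd y (v (inord (bump k 1))))
        (crd y (v (inord (bump k 2)))) (crd y (v (inord (bump k 3)))).
    by apply/funext => y; rewrite wE !lift_slot.
  have H := is_derive_alt4 aW (is_derive_crd x (v k) (v (inord (bump k 0))))
    (is_derive_crd x (v k) (v (inord (bump k 1))))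
    (is_derive_crd x (v k) (v (inord (bump k 2))))
    (is_derive_crd x (v k) (v (inord (bump k 3)))).
  by rewrite derive_val.
have DC i j : D i j = 1 *: dstr (u i) (u j) + D j i.
  by rewrite scale1r addrC; exact: dcrdC.
rewrite -(antisym_alt4 u DC aW) /extd !big_ord_recl big_ord0 !termE.
clear wE DC termE; clearbody D u.
by rewrite /= /bump /=; ring.
Qed.

End Coordinates.

(** * Vector fields on the quotient and connection forms *)

Section InvariantFields.
Context {R : realType} (M : h19_nilmanifold R).
Local Notation V := 'rV[R]_6.
Local Notation E := (frame M).
Local Notation Gam := (gamma M).

(** The differential of a left translation is linear because the multiplication
    is differentiable. *)
Lemma dleft_linear a x c u v :
  dleft M a x (c *: u + v) = c *: dleft M a x u + dleft M a x v.
Proof.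
have dm : differentiable (lg_mul M a) x.
  apply: (@differentiable_comp _ _ _ _ (fun y => (a, y))
    (fun p : V * V => lg_mul M p.1 p.2)).
    by apply: differentiable_pair; [exact: differentiable_cst|].
  exact: smooth_diff (lg_mul_smooth M).
by rewrite /dleft !deriveE // linearP.
Qed.

Lemma on_M_frame i : on_M M (E i).
Proof.
have [sE iE] := frame_inv M i; split=> // a x _; exact: iE.
Qed.

Lemma on_M_add X Y : on_M M X -> on_M M Y -> on_M M (fun y => X y + Y y).
Proof.
move=> [sX iX] [sY iY]; split=> [k|a x Ga]; first exact: CkD.
by rewrite iX // iY // -[dleft M a x (X x)]scale1r -dleft_linear scale1r.
Qed.

Lemma on_M_scale f X :
  inv_function M Gam f -> on_M M X -> on_M M (fun y => f y *: X y).
Proof.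
move=> [sf jf] [sX iX]; split=> [k|a x Ga]; first exact: CkZ.
have dleft0 : dleft M a x 0 = 0.
  by have := dleft_linear a x (-1) 0 0;
    rewrite scaleN1r oppr0 addr0 scaleN1r addNr.
by rewrite jf // iX // -[_ *: X x]addr0 dleft_linear dleft0 addr0.
Qed.

Lemma on_M_cst0 : on_M M (fun=> 0).
Proof.
have f0 : inv_function M Gam (fun=> 0).
  by split=> // k; exact: Ck_cst.
have := on_M_scale f0 (on_M_frame ord0).
by under eq_fun do rewrite scale0r.
Qed.

Lemma on_M_comb (f : 'I_6 -> V -> R) (r : seq 'I_6) :
  (forall i, inv_function M Gam (f i)) ->
  on_M M (fun y => \sum_(i <- r) f i y *: E i y).
Proof.
move=> fI; elim: r => [|i r IH].
  by under eq_fun do rewrite big_nil; exact: on_M_cst0.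
under eq_fun do rewrite big_cons.
by apply: on_M_add => //; apply: on_M_scale => //; exact: on_M_frame.
Qed.

(** The coordinates of a field on the quotient are functions on the quotient, as
    the coframe is left invariant. *)
Lemma inv_coord i Y : on_M M Y -> inv_function M Gam (fun y => crd M y (Y y) 0 i).
Proof.
move=> [sY iY]; split=> [k|a x Ga]; last first.
  have := invform_inv (coframe_inv M i) (a := a) x (fun=> Y x) I.
  by rewrite iY // !mxE.
rewrite [X in Ck _ X](_ : _ =
    fun y => \sum_j Y y 0 j * co M i y (delta_mx 0 j)).
  apply: Ck_sum => j; apply: CkM; last exact: smooth_co.
  by apply: Ck_coord; exact: sY.
apply/funext => y; rewrite mxE {1}[Y y]row_sum_delta.
by apply: linear_form_sum => *; exact: co_linear.
Qed.

Section Connection.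
Context (D : connection (R := R)) (connD : is_connection M D).

Lemma conn0 x v : D x v (fun=> 0) = 0.
Proof.
have := conn_add connD x v on_M_cst0 on_M_cst0.
by under eq_fun do rewrite addr0; rewrite -[LHS]addr0 => /addrI.
Qed.

Lemma conn_comb (f : 'I_6 -> V -> R) (r : seq 'I_6) x v :
  (forall i, inv_function M Gam (f i)) ->
  D x v (fun y => \sum_(i <- r) f i y *: E i y) =
  \sum_(i <- r) ('D_v (f i) x *: E i x + f i x *: D x v (E i)).
Proof.
move=> fI; elim: r => [|i r IH].
  by under eq_fun do rewrite big_nil; rewrite conn0 big_nil.
under eq_fun do rewrite big_cons.
rewrite big_cons -IH -(conn_leibniz connD) //; last exact: on_M_frame.
apply: (conn_add connD); last exact: on_M_comb.
by apply: on_M_scale => //; exact: on_M_frame.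
Qed.

(** A connection is determined by its connection forms: an invariant field is
    a combination of the frame with invariant coefficients, to which the
    Leibniz rule applies. *)
Lemma conn_coord x v Y i : on_M M Y ->
  crd M x (D x v Y) 0 i = 'D_v (fun y => crd M y (Y y) 0 i) x
    + \sum_j crd M x (D x v (E j)) 0 i * crd M x (Y x) 0 j.
Proof.
move=> YM.
have {1}-> : Y = fun y => \sum_i crd M y (Y y) 0 i *: E i y.
  by apply/funext => y; exact: frame_crd.
rewrite (conn_comb (f := fun i y => crd M y (Y y) 0 i)) => [|j]; last first.
  exact: inv_coord.
rewrite big_split linearD mxE /=; congr (_ + _).
  rewrite -[LHS]/(crd M x _ 0 i).
  exact: (crd_comb M x (fun j => 'D_v (fun y => crd M y (Y y) 0 j) x)).
rewrite linear_sum summxE; apply: eq_bigr => j _.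
by rewrite linearZ mxE mulrC.
Qed.

(** The forms of a connection are tensorial in the direction. *)
Lemma conn_form_frame x v j i :
  crd M x (D x v (E j)) 0 i =
  \sum_k crd M x v 0 k * crd M x (D x (E k x) (E j)) 0 i.
Proof.
rewrite {1}(frame_crd M x v).
apply: (linear_form_sum (L := fun w => crd M x (D x w (E j)) 0 i)) => c u w.
by rewrite (conn_linear connD) ?crd_linear ?mxE //; exact: on_M_frame.
Qed.

End Connection.

Lemma derive_coord x h Y i : smooth Y ->
  'D_h (fun y => crd M y (Y y) 0 i) x =
  dcrd M x h (Y x) 0 i + crd M x ('D_h Y x) 0 i.
Proof.
move=> sY.
have lin y c u w : crd M y (c *: u + w) 0 i = c * crd M y u 0 i + crd M y w 0 i.
  by rewrite crd_linear !mxE.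
have dL u : is_derive x h (fun y => crd M y u 0 i) (dcrd M x h u 0 i).
  have H := is_derive_crd M x h u.
  have D : derivable (fun y => crd M y u) x h by [].
  apply: DeriveDef; first by move/derivable_mxP : D.
  by rewrite -(@derive_val _ _ _ _ _ _ _ H) derive_mx // mxE.
have HY : is_derive x h Y ('D_h Y x).
  by apply: derivableP; exact: smooth_derivable.
have H := is_derive_pairing lin dL HY.
by rewrite derive_val.
Qed.

(** The coordinates of the frame are constant, so differentiating them by the
    product rule exchanges the derivatives of the frame for those of the
    coframe. *)
Lemma crd_bracket_frame x i j :
  crd M x (bracket (E i) (E j) x) = - dstr (delta_mx 0 i) (delta_mx 0 j).
Proof.
have dE h k : crd M x ('D_h (E k) x) = - dcrd M x h (E k x).
  apply/rowP => l; rewrite [RHS]mxE.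
  have sE : smooth (E k) by case: (frame_inv M k).
  have := derive_coord x h l sE.
  have -> : (fun y => crd M y (E k y) 0 l) = fun=> (delta_mx 0 k : V) 0 l.
    by apply/funext => y; rewrite crd_frame.
  by rewrite derive_cst => /eqP; rewrite eq_sym addrC addr_eq0 => /eqP.
rewrite /bracket linearB /= !dE (dcrdC M x (E i x)) !crd_frame.
by rewrite opprD opprK addrAC addNr add0r.
Qed.

End InvariantFields.

(** * The invariant tensors in coordinates *)

Section InvariantTensors.
Context {R : realType}.
Local Notation U := 'rV[R]_6.

Definition dot (u v : U) : R := \sum_i u 0 i * v 0 i.

Definition Jstr (u : U) : U := locked (
  u 0 (ix 2) *: bvec 1 - u 0 (ix 1) *: bvec 2
  + u 0 (ix 4) *: bvec 3 - u 0 (ix 3) *: bvec 4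
  + u 0 (ix 6) *: bvec 5 - u 0 (ix 5) *: bvec 6).

Definition e2 i j (u v : U) : R :=
  u 0 (ix i) * v 0 (ix j) - u 0 (ix j) * v 0 (ix i).

Definition e3 i j k (u v w : U) : R :=
  u 0 (ix i) * e2 j k v w - v 0 (ix i) * e2 j k u w + w 0 (ix i) * e2 j k u v.

(** The value of the exterior product of two two-forms on four vectors; see
    [wedge22]. *)
Definition prod22 (A B : U -> U -> R) (a b c d : U) : R :=
  A a b * B c d - A a c * B b d + A a d * B b c
  + A b c * B a d - A b d * B a c + A c d * B a b.

Definition omega (u v : U) : R := e2 1 2 u v + e2 3 4 u v + e2 5 6 u v.

Definition domega (u v w : U) : R :=
  2 * (e3 2 3 5 u v w - e3 1 4 5 u v w - e3 1 3 5 u v w - e3 2 4 5 u v w).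

Definition tors (u v w : U) : R :=
  2 * (e3 1 3 6 u v w + e3 1 4 6 u v w - e3 2 3 6 u v w + e3 2 4 6 u v w).

(** Twice g(nabla_u v, w) for the Levi-Civita connection on invariant fields. *)
Definition koszul (u v w : U) : R :=
  dot (dstr v w) u - dot (dstr u v) w - dot (dstr w u) v.

(** [f] is indexed from 1, like the frame. *)
Definition skew (f : nat -> nat -> R) (i j : 'I_6) : R :=
  if (i < j)%N then f i.+1 j.+1 else if (j < i)%N then - f j.+1 i.+1 else 0.

(** The values at [u] of the forms g(nabla_X E_q, E_p), p < q, of the
    Bismut-Strominger connection; likewise [chern_upper] for the Chern
    connection. *)
Definition plus_upper (u : U) (p q : nat) : R :=
  match p, q with
  | 1, 3 | 2, 4 => - u 0 (ix 5) - 2 * u 0 (ix 6)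
  | 1, 4 => - u 0 (ix 6)
  | 2, 3 => u 0 (ix 6)
  | 1, 5 | 2, 6 => - u 0 (ix 3)
  | 1, 6 => u 0 (ix 4)
  | 2, 5 => - u 0 (ix 4)
  | 3, 5 | 4, 6 => - u 0 (ix 1)
  | 3, 6 => u 0 (ix 2)
  | 4, 5 => - u 0 (ix 2)
  | _, _ => 0
  end.

Definition chern_upper (u : U) (p q : nat) : R :=
  match p, q with
  | 1, 3 | 2, 4 => - u 0 (ix 5)
  | 1, 4 => u 0 (ix 6)
  | 2, 3 => - u 0 (ix 6)
  | 1, 5 | 2, 6 => - u 0 (ix 4)
  | 1, 6 => - u 0 (ix 3)
  | 2, 5 => u 0 (ix 3)
  | 3, 5 | 4, 6 => u 0 (ix 2)
  | 3, 6 => u 0 (ix 1)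
  | 4, 5 => - u 0 (ix 1)
  | _, _ => 0
  end.

Definition plus_form i j (u : U) := skew (plus_upper u) i j.
Definition chern_form i j (u : U) := skew (chern_upper u) i j.

Lemma bvecE j k : (0 < j <= 6)%N -> (0 < k <= 6)%N ->
  (delta_mx 0 (ix j) : U) 0 (ix k) = (k == j)%:R.
Proof. by move=> hj hk; rewrite mxE eqxx /= eq_ix. Qed.

Section Entries.
Context (u v : U).

Lemma dstr1 : dstr u v 0 (ix 1) = 0.
Proof. by rewrite /dstr -lock !mxE !eq_ix //=; ring. Qed.

Lemma dstr2 : dstr u v 0 (ix 2) = 0.
Proof. by rewrite /dstr -lock !mxE !eq_ix //=; ring. Qed.

Lemma dstr3 : dstr u v 0 (ix 3) = 2 * e2 1 5 u v.
Proof. by rewrite /dstr -lock !mxE !eq_ix //= /e2; ring. Qed.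

Lemma dstr4 : dstr u v 0 (ix 4) = 2 * e2 2 5 u v.
Proof. by rewrite /dstr -lock !mxE !eq_ix //= /e2; ring. Qed.

Lemma dstr5 : dstr u v 0 (ix 5) = 0.
Proof. by rewrite /dstr -lock !mxE !eq_ix //=; ring. Qed.

Lemma dstr6 : dstr u v 0 (ix 6) = 2 * (e2 1 3 u v + e2 2 4 u v).
Proof. by rewrite /dstr -lock !mxE !eq_ix //= /e2; ring. Qed.

Lemma Jstr1 : Jstr u 0 (ix 1) = u 0 (ix 2).
Proof. by rewrite /Jstr -lock !mxE !eq_ix //=; ring. Qed.

Lemma Jstr2 : Jstr u 0 (ix 2) = - u 0 (ix 1).
Proof. by rewrite /Jstr -lock !mxE !eq_ix //=; ring. Qed.

Lemma Jstr3 : Jstr u 0 (ix 3) = u 0 (ix 4).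
Proof. by rewrite /Jstr -lock !mxE !eq_ix //=; ring. Qed.

Lemma Jstr4 : Jstr u 0 (ix 4) = - u 0 (ix 3).
Proof. by rewrite /Jstr -lock !mxE !eq_ix //=; ring. Qed.

Lemma Jstr5 : Jstr u 0 (ix 5) = u 0 (ix 6).
Proof. by rewrite /Jstr -lock !mxE !eq_ix //=; ring. Qed.

Lemma Jstr6 : Jstr u 0 (ix 6) = - u 0 (ix 5).
Proof. by rewrite /Jstr -lock !mxE !eq_ix //=; ring. Qed.

End Entries.

Lemma row_scale_add c (u v : U) k : (c *: u + v) 0 k = c * u 0 k + v 0 k.
Proof. by rewrite !mxE. Qed.

Lemma row_sub (u v : U) k : (u - v) 0 k = u 0 k - v 0 k.
Proof. by rewrite !mxE. Qed.

End InvariantTensors.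

Notation entries := (dstr1, dstr2, dstr3, dstr4, dstr5, dstr6,
  (Jstr1, Jstr2, Jstr3, Jstr4, Jstr5, Jstr6)).

(* Comparing two coordinates must not compute their indices. *)
Opaque ix.

(* Reduces an identity between invariant tensors to one between polynomials in
   the coordinates of their arguments. *)
Ltac coords := rewrite /prod22 /koszul /dot ?sum_ix /omega /domega /tors /e3 /e2;
   rewrite ?entries /e2 ?row_scale_add ?bvecE //=.

Section TensorIdentities.
Context {R : realType}.
Local Notation U := 'rV[R]_6.

Lemma alt2_omega : alt2 (omega (R := R)).
Proof. by split=> [c u' u''|] *; coords; ring. Qed.

Lemma alt3_tors : alt3 (tors (R := R)).
Proof. by split=> [u|*]; [split=> [c u' u''|] *|]; coords; ring. Qed.

Lemma domegaE (u v w : U) :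
  omega (dstr u v) w - omega (dstr u w) v + omega (dstr v w) u = domega u v w.
Proof. by coords; ring. Qed.

Lemma torsE (u v w : U) : - domega (Jstr u) (Jstr v) (Jstr w) = tors u v w.
Proof. by coords; ring. Qed.

Lemma dtorsE (a b c d : U) :
  tors (dstr a b) c d - tors (dstr a c) b d + tors (dstr a d) b c
  + tors (dstr b c) a d - tors (dstr b d) a c + tors (dstr c d) a b =
  - 8 * (prod22 (e2 1 2) (e2 3 4) a b c d + prod22 (e2 1 2) (e2 5 6) a b c d).
Proof. by coords; ring. Qed.

(** The polynomial identities for the connection forms are stated for arbitrary
    vectors, which takes one normalisation instead of one for each entry;
    [sum_delta] then recovers the entries. *)
Lemma sum_skew f (v w : U) :
  \sum_i \sum_j skew f i j * v 0 j * w 0 i =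
  f 1 2 * e2 1 2 w v + f 1 3 * e2 1 3 w v + f 1 4 * e2 1 4 w v
  + f 1 5 * e2 1 5 w v + f 1 6 * e2 1 6 w v + f 2 3 * e2 2 3 w v
  + f 2 4 * e2 2 4 w v + f 2 5 * e2 2 5 w v + f 2 6 * e2 2 6 w v
  + f 3 4 * e2 3 4 w v + f 3 5 * e2 3 5 w v + f 3 6 * e2 3 6 w v
  + f 4 5 * e2 4 5 w v + f 4 6 * e2 4 6 w v + f 5 6 * e2 5 6 w v.
Proof. by rewrite !sum_ix /skew !val_ix //= /e2; ring. Qed.

Lemma sum_delta (t : 'I_6 -> 'I_6 -> R) i j :
  \sum_k \sum_l t k l * (delta_mx 0 j : U) 0 l * (delta_mx 0 i : U) 0 k = t i j.
Proof.
rewrite (bigD1 i) //= [X in _ + X]big1 ?addr0 => [|k /negPf ki]; last first.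
  by rewrite big1 // => l _; rewrite !mxE ki andbF mulr0.
rewrite (bigD1 j) //= [X in _ + X]big1 ?addr0 => [|l /negPf lj].
  by rewrite !mxE !eqxx !mulr1.
by rewrite !mxE lj andbF mulr0 mul0r.
Qed.

Lemma plus_formE (u v w : U) : koszul u v w + tors u v w =
  2 * \sum_i \sum_j plus_form i j u * v 0 j * w 0 i.
Proof. by rewrite sum_skew /=; coords; ring. Qed.

Lemma chern_formE (u v w : U) : koszul u v w + domega (Jstr u) v w =
  2 * \sum_i \sum_j chern_form i j u * v 0 j * w 0 i.
Proof. by rewrite sum_skew /=; coords; ring. Qed.

End TensorIdentities.

(** * Curvature and first Pontrjagin form of constant connection forms *)

Section Curvature.
Context {R : realType}.
Local Notation U := 'rV[R]_6.

Lemma sum_lt_ix (A : nmodType) (F : 'I_6 -> 'I_6 -> A) :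
  \sum_(i < 6) \sum_(j < 6 | (i < j)%N) F i j =
  F (ix 1) (ix 2) + F (ix 1) (ix 3) + F (ix 1) (ix 4) + F (ix 1) (ix 5) +
  F (ix 1) (ix 6) + F (ix 2) (ix 3) + F (ix 2) (ix 4) + F (ix 2) (ix 5) +
  F (ix 2) (ix 6) + F (ix 3) (ix 4) + F (ix 3) (ix 5) + F (ix 3) (ix 6) +
  F (ix 4) (ix 5) + F (ix 4) (ix 6) + F (ix 5) (ix 6).
Proof.
under eq_bigr => i _ do rewrite big_mkcond.
by rewrite !sum_ix !val_ix //= !(add0r, addr0) !addrA.
Qed.

(** The curvature forms d t + t /\ t of constant connection forms [t]. *)
Definition curv (t : 'I_6 -> 'I_6 -> U -> R) i j (u v : U) : R :=
  t i j (dstr u v) + \sum_k (t i k u * t k j v - t i k v * t k j u).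

(** The curvature forms Omega^p_q, p < q, of the connections with forms
    [plus_form] and [chern_form]. *)
Definition plus_curv_upper (u v : U) (p q : nat) : R :=
  match p, q with
  | 1, 2 => - (2 * e2 3 4 u v) + 2 * e2 5 6 u v
  | 1, 3 => - (3 * e2 1 3 u v) - 3 * e2 2 4 u v
  | 1, 4 => - (2 * e2 1 3 u v) - e2 1 4 u v + e2 2 3 u v - 2 * e2 2 4 u v
  | 1, 5 => - (3 * e2 1 5 u v) - 2 * e2 1 6 u v - e2 2 6 u v
  | 1, 6 => - e2 1 6 u v + 3 * e2 2 5 u v + 2 * e2 2 6 u v
  | 2, 3 => 2 * e2 1 3 u v + e2 1 4 u v - e2 2 3 u v + 2 * e2 2 4 u v
  | 2, 4 => - (3 * e2 1 3 u v) - 3 * e2 2 4 u v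
  | 2, 5 => e2 1 6 u v - 3 * e2 2 5 u v - 2 * e2 2 6 u v
  | 2, 6 => - (3 * e2 1 5 u v) - 2 * e2 1 6 u v - e2 2 6 u v
  | 3, 4 => - (2 * e2 1 2 u v) - 2 * e2 5 6 u v
  | 3, 5 => e2 3 5 u v + 2 * e2 3 6 u v - e2 4 6 u v
  | 3, 6 => - e2 3 6 u v - e2 4 5 u v - 2 * e2 4 6 u v
  | 4, 5 => e2 3 6 u v + e2 4 5 u v + 2 * e2 4 6 u v
  | 4, 6 => e2 3 5 u v + 2 * e2 3 6 u v - e2 4 6 u v
  | 5, 6 => 2 * e2 1 2 u v + 2 * e2 3 4 u v
  | _, _ => 0
  end.

Definition chern_curv_upper (u v : U) (p q : nat) : R :=
  match p, q with
  | 1, 2 => - (2 * e2 3 4 u v) - 2 * e2 5 6 u v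
  | 1, 3 => - e2 1 3 u v - e2 2 4 u v
  | 1, 4 => 2 * e2 1 3 u v + e2 1 4 u v - e2 2 3 u v + 2 * e2 2 4 u v
  | 1, 5 => e2 1 6 u v - e2 2 5 u v
  | 1, 6 => - e2 1 5 u v - e2 2 6 u v
  | 2, 3 => - (2 * e2 1 3 u v) - e2 1 4 u v + e2 2 3 u v - 2 * e2 2 4 u v
  | 2, 4 => - e2 1 3 u v - e2 2 4 u v
  | 2, 5 => e2 1 5 u v + e2 2 6 u v
  | 2, 6 => e2 1 6 u v - e2 2 5 u v
  | 3, 4 => - (2 * e2 1 2 u v) + 2 * e2 5 6 u v
  | 3, 5 => - e2 3 6 u v + e2 4 5 u v
  | 3, 6 => e2 3 5 u v + e2 4 6 u v
  | 4, 5 => - e2 3 5 u v - e2 4 6 u v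
  | 4, 6 => - e2 3 6 u v + e2 4 5 u v
  | 5, 6 => 2 * e2 1 2 u v + 2 * e2 3 4 u v
  | _, _ => 0
  end.

Lemma plus_curvE (i j : 'I_6) u v : (i < j)%N ->
  curv plus_form i j u v = plus_curv_upper u v i.+1 j.+1.
Proof.
move: i j; do 2 (apply: all_ix); rewrite !val_ix //= => _;
 rewrite /curv sum_ix /plus_form /skew !val_ix //= ?entries /e2; ring.
Qed.

Lemma chern_curvE (i j : 'I_6) u v : (i < j)%N ->
  curv chern_form i j u v = chern_curv_upper u v i.+1 j.+1.
Proof.
move: i j; do 2 (apply: all_ix); rewrite !val_ix //= => _;
 rewrite /curv sum_ix /chern_form /skew !val_ix //= ?entries /e2; ring.
Qed.

Definition pontrjagin_sum (W : 'I_6 -> 'I_6 -> U -> U -> R) a b c d : R :=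
  \sum_(i < 6) \sum_(j < 6 | (i < j)%N) prod22 (W i j) (W i j) a b c d.

Lemma p1_plus (a b c d : U) : pontrjagin_sum (curv plus_form) a b c d =
  - 48 * prod22 (e2 1 2) (e2 3 4) a b c d - 16 * prod22 (e2 1 2) (e2 5 6) a b c d.
Proof.
rewrite /pontrjagin_sum.
under eq_bigr => i _ do under eq_bigr => j ij do rewrite /prod22 !plus_curvE //.
by rewrite sum_lt_ix !val_ix //= /prod22 /e2; ring.
Qed.

Lemma p1_chern (a b c d : U) : pontrjagin_sum (curv chern_form) a b c d =
  - 16 * prod22 (e2 1 2) (e2 3 4) a b c d - 16 * prod22 (e2 1 2) (e2 5 6) a b c d.
Proof.
rewrite /pontrjagin_sum.
under eq_bigr => i _ do under eq_bigr => j ij do rewrite /prod22 !chern_curvE //.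
by rewrite sum_lt_ix !val_ix //= /prod22 /e2; ring.
Qed.

End Curvature.

Section Algebra.
Context {R : realType}.
Local Notation U := 'rV[R]_6.

Definition lin_form (L : U -> R) := forall c u u', L (c *: u + u') = c * L u + L u'.

Lemma koszul_lin1 v w : lin_form (fun u => koszul u v w).
Proof. by move=> c u u'; coords; ring. Qed.

Lemma tors_lin2 u w : lin_form (fun v => tors u v w).
Proof. by move=> c v v'; coords; ring. Qed.

Lemma lin_form_basis L (u : U) : lin_form L -> L u = \sum_j u 0 j * L (delta_mx 0 j).
Proof. by move=> lL; rewrite {1}[u]row_sum_delta; exact: linear_form_sum. Qed.

Lemma skew_lin (f : U -> nat -> nat -> R) i j :
  (forall p q, lin_form (fun u => f u p q)) -> lin_form (fun u => skew (f u) i j).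
Proof.
by move=> lf c u u'; rewrite /skew; case: ifP => _; [|case: ifP => _];
  rewrite ?lf; ring.
Qed.

Lemma plus_form_lin i j : lin_form (plus_form i j).
Proof.
apply: (skew_lin (f := plus_upper)) => p q c u u'.
(* every entry with an index above 6 is 0 *)
do 7 (case: p => [|p]; first by
  do 7 (case: q => [|q]; first by rewrite /= ?row_scale_add; ring);
  rewrite /=; ring).
by rewrite /=; ring.
Qed.

Lemma chern_form_lin i j : lin_form (chern_form i j).
Proof.
apply: (skew_lin (f := chern_upper)) => p q c u u'.
do 7 (case: p => [|p]; first by
  do 7 (case: q => [|q]; first by rewrite /= ?row_scale_add; ring);
  rewrite /=; ring).
by rewrite /=; ring.
Qed.

Lemma skewC (f : nat -> nat -> R) i j : skew f i j = - skew f j i.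
Proof. by rewrite /skew; case: ltngtP; rewrite ?opprK ?oppr0. Qed.

Lemma dstrC (u v : U) : dstr u v = - dstr v u.
Proof.
apply/rowP => k; rewrite [RHS]mxE; move: k.
by apply: all_ix; rewrite !entries /e2; ring.
Qed.

Lemma lin_formN L u : lin_form L -> L (- u) = - L u.
Proof.
by move=> lL; rewrite -scaleN1r -[_ *: u]addr0 lL (linear_form0 lL) addr0 mulN1r.
Qed.

Lemma curvC (t : 'I_6 -> 'I_6 -> U -> R) i j u v :
  (forall i j, lin_form (t i j)) -> curv t i j u v = - curv t i j v u.
Proof.
move=> lt; rewrite /curv dstrC lin_formN // opprD.
by congr (_ + _); rewrite -sumrN; apply: eq_bigr => k _; ring.
Qed.

Definition act_form (t : 'I_6 -> 'I_6 -> U -> R) (u v : U) : U :=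
  \row_i \sum_j t i j u * v 0 j.

(** The connection forms take their values in u(3). *)
Lemma act_plusJ (u v : U) :
  act_form plus_form u (Jstr v) = Jstr (act_form plus_form u v).
Proof.
by apply/rowP; apply: all_ix; rewrite !entries !mxE !sum_ix !entries
  /plus_form /skew !val_ix //=; ring.
Qed.

(** [Jstr] has only six nonzero entries in the standard basis. *)
Lemma trace_J (W : 'I_6 -> 'I_6 -> R) :
  \sum_i \sum_j W i j * Jstr (delta_mx 0 i) 0 j =
  W (ix 2) (ix 1) - W (ix 1) (ix 2) + (W (ix 4) (ix 3) - W (ix 3) (ix 4))
  + (W (ix 6) (ix 5) - W (ix 5) (ix 6)).
Proof.
under eq_bigr => i _ do rewrite sum_ix !entries.
by rewrite sum_ix !bvecE //=; ring.
Qed.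

(** The curvature lies in su(3): in the complex trace, Omega^1_2, Omega^3_4 and
    Omega^5_6 add up to 0. *)
Lemma plus_curv_trace (u v : U) :
  \sum_i \sum_j curv plus_form i j u v * Jstr (delta_mx 0 i) 0 j = 0.
Proof.
by rewrite trace_J /curv !sum_ix /plus_form /skew !val_ix //=; ring.
Qed.

Definition tors_vec (u v : U) : U := \row_k tors u v (delta_mx 0 k).

(** In complex language, the torsion has no component of type (3,0) + (0,3). *)
Lemma tors_vecJ (u v : U) :
  tors_vec (Jstr u) (Jstr v) - Jstr (tors_vec (Jstr u) v)
  - Jstr (tors_vec u (Jstr v)) - tors_vec u v = 0.
Proof.
have tE w w' i : tors_vec w w' 0 i = tors w w' (delta_mx 0 i) by rewrite mxE.
move: (tE (Jstr u) (Jstr v)) (tE (Jstr u) v) (tE u (Jstr v)) (tE u v).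
move: (tors_vec (Jstr u) (Jstr v)) (tors_vec (Jstr u) v) (tors_vec u (Jstr v)).
move: (tors_vec u v) => t1 t2 t3 t4 E2 E3 E4 E1.
apply/rowP => k; rewrite !row_sub [RHS]mxE; move: k.
by apply: all_ix; rewrite !entries E1 E2 E3 E4; coords; ring.
Qed.

Lemma JstrB (u v : U) : Jstr (u - v) = Jstr u - Jstr v.
Proof.
by apply/rowP; apply: all_ix; rewrite row_sub !entries row_sub; ring.
Qed.

Lemma dot_omega (u v : U) : dot u (Jstr v) = omega u v.
Proof. by coords; ring. Qed.

Lemma dot_Jstr (u v : U) : dot (Jstr u) (Jstr v) = dot u v.
Proof. by coords; ring. Qed.

Lemma Jstr_sqr (u : U) : Jstr (Jstr u) = - u.
Proof. by apply/rowP; apply: all_ix; rewrite ?entries mxE. Qed.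

Definition A_sign : 'I_6 -> 'I_6 -> R :=
  skew (fun p q => if (p, q) \in [:: (2, 3); (2, 5); (4, 5)]%N then - 1 else 1).

Definition A_form lambda mu i j (u : U) : R :=
  A_sign i j * (lambda * u 0 (ix 1) + mu * u 0 (ix 6)).

Lemma A_form_lin lambda mu i j : lin_form (A_form lambda mu i j).
Proof. by move=> c u u'; rewrite /A_form !row_scale_add; ring. Qed.

(** All the connection forms are multiples of one one-form, so the quadratic
    part of the curvature vanishes. *)
Lemma A_curvE lambda mu i j u v :
  curv (A_form lambda mu) i j u v =
  A_sign i j * mu * (2 * (e2 1 3 u v + e2 2 4 u v)).
Proof.
rewrite /curv big1 => [|k _]; last by rewrite /A_form; ring.
by rewrite /A_form !entries; ring.
Qed.

Lemma p1_A lambda mu a b c d : pontrjagin_sum (curv (A_form lambda mu)) a b c d =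
  - 120 * mu ^+ 2 * prod22 (e2 1 2) (e2 3 4) a b c d.
Proof.
have sqr_sign (i j : 'I_6) : (i < j)%N -> A_sign i j ^+ 2 = 1.
  by move=> ij; rewrite /A_sign /skew ij; case: ifP => _; rewrite ?sqrrN expr1n.
pose F u v : R := 2 * (e2 1 3 u v + e2 2 4 u v).
transitivity (\sum_(i < 6) \sum_(j < 6 | (i < j)%N) mu ^+ 2 * prod22 F F a b c d).
  apply: eq_bigr => i _; apply: eq_bigr => j ij.
  rewrite -[X in X * _]mul1r -(sqr_sign i j ij) /prod22 !A_curvE /F; ring.
by rewrite sum_lt_ix /F /prod22 /e2; ring.
Qed.

Lemma A_curv_J lambda mu i j u v :
  curv (A_form lambda mu) i j (Jstr u) (Jstr v) = curv (A_form lambda mu) i j u v.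
Proof. by rewrite !A_curvE; coords; ring. Qed.

Lemma A_curv_trace lambda mu i j :
  \sum_k curv (A_form lambda mu) i j (delta_mx 0 k) (Jstr (delta_mx 0 k)) = 0.
Proof.
under eq_bigr => k _ do rewrite A_curvE /e2 !entries.
by rewrite sum_ix !bvecE //=; ring.
Qed.

End Algebra.

(** * The Hermitian structure and its Levi-Civita connection *)

Section Tensors.
Context {R : realType} (M : h19_nilmanifold R).
Local Notation V := 'rV[R]_6.
Local Notation E := (frame M).

Lemma metricE x v w : metric M x v w = dot (crd M x v) (crd M x w).
Proof. by apply: eq_bigr => i _; rewrite !mxE. Qed.

Lemma metric_frame x v i : metric M x v (E i x) = crd M x v 0 i.
Proof.
rewrite metricE crd_frame /dot (bigD1 i) //= big1 => [|j /negPf ji].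
  by rewrite !mxE !eqxx mulr1 addr0.
by rewrite [X in _ * X]mxE ji andbF mulr0.
Qed.

Lemma crd_cplx x v : crd M x (cplx M x v) = Jstr (crd M x v).
Proof.
rewrite -(crd_frame_sum M x (Jstr (crd M x v))); congr (crd M x _).
by rewrite sum_ix !entries !scaleNr !mxE.
Qed.

Lemma kaehlerE x v :
  kaehler M x v = omega (crd M x (v (inord 0))) (crd M x (v (inord 1))).
Proof.
rewrite /kaehler metricE crd_cplx dot_omega.
by congr (omega (crd M x (v _)) (crd M x (v _))); apply: val_inj; rewrite /= inordK.
Qed.

Lemma d_kaehlerE x v : extd (kaehler M) x v =
  domega (crd M x (v (inord 0))) (crd M x (v (inord 1))) (crd M x (v (inord 2))).
Proof.
rewrite (extd2 x v kaehlerE (alt2_omega (R := R))) /=; exact: domegaE.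
Qed.

Lemma torsionE x v : torsion M x v =
  tors (crd M x (v (inord 0))) (crd M x (v (inord 1))) (crd M x (v (inord 2))).
Proof. by rewrite /torsion d_kaehlerE !crd_cplx torsE. Qed.

Lemma d_torsionE x v : let u k := crd M x (v (inord k)) in
  extd (torsion M) x v =
  - 8 * (prod22 (e2 1 2) (e2 3 4) (u 0%N) (u 1%N) (u 2%N) (u 3%N)
         + prod22 (e2 1 2) (e2 5 6) (u 0%N) (u 1%N) (u 2%N) (u 3%N)).
Proof.
move=> u; rewrite (extd3 x v torsionE (alt3_tors (R := R))) /=; exact: dtorsE.
Qed.

Section ConnectionForms.
Context (D : connection (R := R)) (t : 'I_6 -> 'I_6 -> V -> R).
Hypothesis tE : forall i j x v,
  conn_form M D i j x v = t i j (crd M x (v (inord 0))).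
Hypothesis t_lin : forall i j, lin_form (t i j).

Lemma curv_formE i j x v : curv_form M D i j x v =
  curv t i j (crd M x (v (inord 0))) (crd M x (v (inord 1))).
Proof.
rewrite /curv_form (extd1 x v (tE i j) (@t_lin i j)); congr (_ + _).
by apply: eq_bigr => k _; rewrite wedge11 !tE.
Qed.

Lemma pontrjagin1E x v : pontrjagin1 M D x v = (8 * pi ^+ 2)^-1 *
  pontrjagin_sum (curv t) (crd M x (v (inord 0))) (crd M x (v (inord 1)))
    (crd M x (v (inord 2))) (crd M x (v (inord 3))).
Proof.
congr (_ * _); apply: eq_bigr => i _; apply: eq_bigr => j _.
pose W (a b : V) := curv t i j (crd M x a) (crd M x b).
have WC a b : W a b = - W b a by exact: curvC.
have WE w : curv_form M D i j x w = W (w (inord 0)) (w (inord 1)).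
  exact: curv_formE.
by rewrite (wedge22 v WE WE WC WC).
Qed.

Lemma crd_curvature x v w u i : crd M x (curvature M D x v w u) 0 i =
  \sum_j curv t i j (crd M x v) (crd M x w) * crd M x u 0 j.
Proof.
rewrite -[RHS](crd_comb M x
  (fun i => \sum_j curv t i j (crd M x v) (crd M x w) * crd M x u 0 j)).
congr (crd M x _ 0 i).
apply: eq_bigr => k _; rewrite scaler_suml; apply: eq_bigr => j _.
rewrite curv_formE /vec2 !(tnth_nth 0) !inordK //=.
by rewrite mxE.
Qed.

End ConnectionForms.

Section LeviCivita.
Context (D : connection (R := R)) (lcD : levi_civita M D).
Let connD := lc_connection lcD.

(** Koszul's formula; the frame is orthonormal, so the derivatives of the
    metric drop out. *)
Lemma levi_civitaE x v j i : 2 * crd M x (D x v (E j)) 0 i =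
  koszul (crd M x v) (delta_mx 0 j) (delta_mx 0 i).
Proof.
pose G a b c := crd M x (D x (E a x) (E b)) 0 c.
pose C a b c : R := dstr (delta_mx 0 a : V) (delta_mx 0 b) 0 c.
have Gskew a b c : G a b c = - G a c b.
  have := lc_metric lcD x (E a x) (on_M_frame M b) (on_M_frame M c).
  have -> : (fun y => metric M y (E b y) (E c y)) = fun=> (delta_mx 0 b : V) 0 c.
    by apply/funext => y; rewrite metric_frame crd_frame.
  have metricC y u w : metric M y u w = metric M y w u.
    by apply: eq_bigr => k _; rewrite mulrC.
  rewrite derive_cst metric_frame metricC metric_frame => /esym/eqP.
  by rewrite addr_eq0 => /eqP.
have Gtors a b c : G a b c - G b a c = - C a b c.
  have := lc_torsion_free lcD (on_M_frame M a) (on_M_frame M b) x.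
  move=> /(congr1 (fun w => crd M x w 0 c)).
  have rowN (u : V) : (- u) 0 c = - u 0 c by rewrite !mxE.
  by rewrite crd_bracket_frame linearB row_sub rowN.
have dotd (w : V) k : dot w (delta_mx 0 k) = w 0 k.
  rewrite -(crd_frame M x k) -[w in LHS](crd_frame_sum M x w) -metricE.
  by rewrite metric_frame crd_frame_sum.
rewrite (conn_form_frame connD) mulr_sumr (lin_form_basis _ (koszul_lin1 _ _)).
apply: eq_bigr => k _; rewrite mulrCA; congr (_ * _).
rewrite /koszul !dotd -/(C j i k) -/(C k j i) -/(C i k j) -/(G k j i).
(* the torsion and metric identities of the six permutations of [i j k] *)
have := (Gtors k j i, Gtors j i k, Gtors i k j).
have := (Gskew k j i, Gskew j k i, Gskew i k j, Gskew j i k).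
move: (G k j i) (G k i j) (G j k i) (G j i k) (G i k j) (G i j k).
move=> g1 g2 g3 g4 g5 g6 [[[E1 E2] E3] E4] [[F1 F2] F3].
lra.
Qed.

End LeviCivita.
End Tensors.

(** * The Bismut-Strominger and Chern connections *)

Section Connections.
Context {R : realType} (M : h19_nilmanifold R).
Local Notation V := 'rV[R]_6.
Local Notation E := (frame M).

Lemma crd_shift (D : connection (R := R)) S x v Y i :
  crd M x (shift_connection M D S x v Y) 0 i =
  crd M x (D x v Y) 0 i + S x v (Y x) (E i x).
Proof.
rewrite /shift_connection linearD mxE; congr (_ + _).
exact: (crd_comb M x (fun k => S x v (Y x) (E k x))).
Qed.

Lemma vec3E (a b c : V) :
  [/\ vec3 a b c (inord 0) = a, vec3 a b c (inord 1) = b & vec3 a b c (inord 2) = c].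
Proof. by split; rewrite /vec3 (tnth_nth 0) inordK. Qed.

Lemma vec2E (a b : V) : vec2 a b (inord 0) = a /\ vec2 a b (inord 1) = b.
Proof. by split; rewrite /vec2 (tnth_nth 0) inordK. Qed.

Section LeviCivita.
Context (D : connection (R := R)) (lcD : levi_civita M D).
Let connD := lc_connection lcD.

Lemma crd_plus x v Y i : crd M x (nabla_plus M D x v Y) 0 i =
  crd M x (D x v Y) 0 i
  + 2^-1 * tors (crd M x v) (crd M x (Y x)) (delta_mx 0 i).
Proof.
rewrite crd_shift torsionE; have [-> -> ->] := vec3E v (Y x) (E i x).
by rewrite crd_frame.
Qed.

Lemma conn_form_plus i j x v :
  conn_form M (nabla_plus M D) i j x v = plus_form i j (crd M x (v (inord 0))).
Proof.
rewrite /conn_form metric_frame crd_plus.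
have -> : inord 0 = ord0 :> 'I_1 by apply: ord_inj; rewrite inordK.
have := levi_civitaE lcD x (v ord0) j i.
have := plus_formE (crd M x (v ord0)) (delta_mx 0 j) (delta_mx 0 i).
rewrite sum_delta !crd_frame; lra.
Qed.

Lemma conn_form_chern i j x v :
  conn_form M (nabla_chern M D) i j x v = chern_form i j (crd M x (v (inord 0))).
Proof.
rewrite /conn_form metric_frame crd_shift d_kaehlerE.
have [-> -> ->] := vec3E (cplx M x (v ord0)) (E j x) (E i x).
have -> : inord 0 = ord0 :> 'I_1 by apply: ord_inj; rewrite inordK.
have := levi_civitaE lcD x (v ord0) j i.
have := chern_formE (crd M x (v ord0)) (delta_mx 0 j) (delta_mx 0 i).
rewrite sum_delta !crd_frame crd_cplx; lra.
Qed.

Local Notation Dp := (nabla_plus M D).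

Lemma plus_coord x v Y i : on_M M Y ->
  crd M x (Dp x v Y) 0 i = 'D_v (fun y => crd M y (Y y) 0 i) x
    + act_form plus_form (crd M x v) (crd M x (Y x)) 0 i.
Proof.
move=> YM; rewrite crd_plus (conn_coord connD) // -addrA; congr (_ + _).
rewrite [RHS]mxE (lin_form_basis _ (tors_lin2 _ _)) mulr_sumr -big_split.
apply: eq_bigr => j _ /=.
have := levi_civitaE lcD x v j i.
have := plus_formE (crd M x v) (delta_mx 0 j) (delta_mx 0 i).
rewrite sum_delta => E1 E2.
have -> : crd M x (D x v (E j)) 0 i =
    plus_form i j (crd M x v)
    - 2^-1 * tors (crd M x v) (delta_mx 0 j) (delta_mx 0 i).
  lra.
ring.
Qed.

Lemma derivable_coord x v Y i : on_M M Y ->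
  derivable (fun y => crd M y (Y y) 0 i) x v.
Proof. by move=> /(inv_coord i)[sf _]; exact: smooth_derivable. Qed.

Lemma on_M_cplx Y : on_M M Y -> on_M M (fun y => cplx M y (Y y)).
Proof.
move=> YM; pose f i y := Jstr (crd M y (Y y)) 0 i.
have -> : (fun y => cplx M y (Y y)) = fun y => \sum_i f i y *: E i y.
  by apply/funext => y; rewrite {1}(frame_crd M y (cplx M y (Y y))) crd_cplx.
have invN g : inv_function M (gamma M) g ->
    inv_function M (gamma M) (fun y => - g y).
  move=> [sg ig]; split=> [k|a x Ga]; last by rewrite ig.
  under eq_fun do rewrite -mulN1r.
  by apply: CkM => //; exact: Ck_cst.
apply: on_M_comb; apply: all_ix; rewrite /f; under eq_fun do rewrite !entries.
- exact: inv_coord.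
- exact/invN/inv_coord.
- exact: inv_coord.
- exact/invN/inv_coord.
- exact: inv_coord.
- exact/invN/inv_coord.
Qed.

Lemma plus_cplx : cplx_parallel M Dp.
Proof.
move=> x v Y YM; apply: (@crd_inj _ M x); rewrite crd_cplx.
have dN i : 'D_v (fun y => - crd M y (Y y) 0 i) x =
    - 'D_v (fun y => crd M y (Y y) 0 i) x.
  by apply: deriveN; exact: derivable_coord.
apply/rowP => i; rewrite plus_coord; last exact: on_M_cplx.
rewrite crd_cplx act_plusJ.
under eq_fun do rewrite crd_cplx.
by move: i; apply: all_ix; rewrite !entries plus_coord // ?opprD -?dN;
  congr (_ + _); congr ('D_v _ x); apply/funext => y; rewrite !entries.
Qed.

(** The derivatives of the coordinates give the Leibniz rule for [dot]; the rest
    cancels because the connection forms are skew. *)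
Lemma plus_metric : metric_connection M Dp.
Proof.
move=> x v Y Z YM ZM.
have HM i := is_deriveM (derivableP (@derivable_coord x v Y i YM))
  (derivableP (@derivable_coord x v Z i ZM)).
have -> : (fun y => metric M y (Y y) (Z y)) =
    \sum_i ((fun y => crd M y (Y y) 0 i) * (fun y => crd M y (Z y) 0 i)).
  by apply/funext => y; rewrite metricE fct_sumE.
have H := is_derive_sum HM.
rewrite (@derive_val _ _ _ _ _ _ _ H) !metricE /dot.
under [X in _ = X + _]eq_bigr => i _ do rewrite plus_coord // mulrDl.
under [X in _ = _ + X]eq_bigr => i _ do rewrite plus_coord // mulrDr.
rewrite !big_split /= addrACA [X in _ = _ + X](_ : _ = 0).
  by rewrite addr0 addrC; congr (_ + _); apply: eq_bigr => i _; exact: mulrC.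
set u := crd M x v; set a := crd M x (Y x); set b := crd M x (Z x).
move: u a b => u a b.
have -> : \sum_i act_form plus_form u a 0 i * b 0 i =
    \sum_i \sum_j plus_form i j u * a 0 j * b 0 i.
  by apply: eq_bigr => i _; rewrite mxE mulr_suml.
have -> : \sum_i a 0 i * act_form plus_form u b 0 i =
    \sum_i \sum_j plus_form i j u * b 0 j * a 0 i.
  by apply: eq_bigr => i _; rewrite mxE mulr_sumr; apply: eq_bigr => j _; ring.
rewrite [X in _ + X]exchange_big -big_split big1 //= => i _.
rewrite -big_split big1 //= => j _.
by rewrite /plus_form [X in _ + X * _ * _]skewC; ring.
Qed.

Lemma plus_hol_su3 : hol_su3 M Dp.
Proof.
split; [exact: plus_metric|exact: plus_cplx|move=> x v w].
under eq_bigr => i _ do rewrite metric_frame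
  (crd_curvature conn_form_plus plus_form_lin) crd_cplx crd_frame.
exact: plus_curv_trace.
Qed.

(** The torsion of the Bismut-Strominger connection is the three-form [tors]. *)
Lemma crd_bracket X Y x k : on_M M X -> on_M M Y ->
  crd M x (bracket X Y x) 0 k =
  crd M x (Dp x (X x) Y) 0 k - crd M x (Dp x (Y x) X) 0 k
  - tors (crd M x (X x)) (crd M x (Y x)) (delta_mx 0 k).
Proof.
move=> XM YM.
have [_ tC] := alt3_tors (R := R).
(* stated for real variables, so that no vector field occurs in the computation *)
have alg (p q a b s s' : R) :
    p = a + 2^-1 * s -> q = b + 2^-1 * s' -> s' = - s -> a - b = p - q - s.
  by move=> -> -> ->; field.
rewrite -(lc_torsion_free lcD XM YM) linearB row_sub.
exact: alg (crd_plus _ _ _ _) (crd_plus _ _ _ _) (tC _ _ _).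
Qed.

(** The integrability of [cplx]: as it is parallel for a connection with
    totally skew torsion [tors], the derivatives cancel in the Nijenhuis
    tensor, and what is left is the type condition [tors_vecJ]. *)
Lemma nijenhuis_eq0 X Y x : on_M M X -> on_M M Y -> nijenhuis M X Y x = 0.
Proof.
move=> XM YM; have JX := on_M_cplx XM; have JY := on_M_cplx YM.
pose P A B : V := crd M x (Dp x (A x) B).
have br A B : on_M M A -> on_M M B -> crd M x (bracket A B x) =
    P A B - P B A - tors_vec (crd M x (A x)) (crd M x (B x)).
  move=> AM BM; apply/rowP => k; rewrite !row_sub [X in _ = _ - X]mxE.
  exact: crd_bracket.
have PJ A B : on_M M B -> P A (fun y => cplx M y (B y)) = Jstr (P A B).
  by move=> BM; rewrite /P plus_cplx // crd_cplx.
have brJJ := br _ _ JX JY; have brJX := br _ _ JX YM.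
have brJY := br _ _ XM JY; have brXY := br _ _ XM YM.
rewrite !PJ // !crd_cplx in brJJ brJX brJY.
have gen (b0 b1 b2 b3 a b c d u v : V) :
    crd M x b0 = Jstr a - Jstr b - tors_vec (Jstr u) (Jstr v) ->
    crd M x b1 = a - Jstr d - tors_vec (Jstr u) v ->
    crd M x b2 = Jstr c - b - tors_vec u (Jstr v) ->
    crd M x b3 = c - d - tors_vec u v ->
    b0 - cplx M x b1 - cplx M x b2 - b3 = 0.
  move=> E0 E1 E2 E3; apply: (@crd_inj _ M x).
  rewrite linear0 3!linearB /= 2!crd_cplx E0 E1 E2 E3 !JstrB !Jstr_sqr.
  rewrite -[RHS]oppr0 -(tors_vecJ u v); apply/rowP => k.
  move: (Jstr (tors_vec (Jstr u) v)) (Jstr (tors_vec u (Jstr v))) => t1 t2.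
  move: (tors_vec (Jstr u) (Jstr v)) (tors_vec u v) (Jstr a) (Jstr b) => t0 t3 a' b'.
  by rewrite !mxE; ring.
exact: gen brJJ brJX brJY brXY.
Qed.

End LeviCivita.
End Connections.

(** * The instanton *)

Section Instanton.
Context {R : realType} (M : h19_nilmanifold R) (lambda mu : R).
Local Notation V := 'rV[R]_6.
Local Notation E := (frame M).
Local Notation A := (A_conn M lambda mu).

Lemma sigmaE i j x v : sigma M lambda mu i j x v =
  A_sign i j * (lambda * coframe M (ix 1) x v + mu * coframe M (ix 6) x v).
Proof.
rewrite /sigma /A_sign /skew; set a := lambda * _ + _.
by case: ifP => _; [|case: ifP => _]; try case: ifP => _; ring.
Qed.

Lemma conn_form_A i j x v :
  conn_form M A i j x v = A_form lambda mu i j (crd M x (v (inord 0))).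
Proof.
have -> : inord 0 = ord0 :> 'I_1 by apply: ord_inj; rewrite inordK.
rewrite /conn_form metric_frame.
transitivity (sigma M lambda mu i j x (fun=> v ord0)).
  rewrite -[RHS](crd_comb M x (fun k => sigma M lambda mu k j x (fun=> v ord0))).
  congr (crd M x _ 0 i); apply: eq_bigr => k _; congr (_ *: _).
  have -> : (fun y => co M k y (E j y)) = fun=> (k == j)%:R.
    by apply/funext => y; rewrite /co dual_frame.
  rewrite derive_cst add0r (bigD1 j) //= big1 => [|l /negPf lj].
    by rewrite /co dual_frame eqxx mulr1 addr0.
  by rewrite /co dual_frame lj mulr0.
by rewrite sigmaE !coframeE /A_form !mxE.
Qed.

Let A_lin := A_form_lin lambda mu.

Lemma A_instanton : su3_instanton M A.
Proof.
split=> [i j x v w|i j x].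
  rewrite !(curv_formE conn_form_A A_lin).
  have [-> ->] := vec2E v w; have [-> ->] := vec2E (cplx M x v) (cplx M x w).
  by rewrite !crd_cplx A_curv_J.
rewrite -[RHS](A_curv_trace lambda mu i j); apply: eq_bigr => k _.
rewrite (curv_formE conn_form_A A_lin).
have [-> ->] := vec2E (E k x) (cplx M x (E k x)).
by rewrite crd_cplx crd_frame.
Qed.

End Instanton.

(** * The Hodge dual of the Kaehler form *)

Section Hodge.
Context {R : realType}.
Local Notation U := 'rV[R]_6.

Lemma det_delta_col n (A : 'M[R]_n.+1) a : (forall i, A i ord0 = (i == a)%:R) ->
  \det A = (-1) ^+ a * \det (row' a (col' ord0 A)).
Proof.
move=> Aa; rewrite (expand_det_col _ ord0) (bigD1 a) //= big1 => [|i /negPf ia].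
  by rewrite Aa eqxx mul1r addr0 /cofactor addn0.
by rewrite Aa ia mul0r.
Qed.

(** Two first columns that are vectors of the standard basis leave a minor of
    size four. [p] lists the four remaining rows, and the minor is written as the
    value of an exterior product on the remaining columns. *)
Lemma det_delta2 (A : 'M[R]_6) (a b : 'I_6) (b' : 'I_5) (u : nat -> U)
    (p : 'I_4 -> nat) :
  lift a b' = b ->
  (forall k : 'I_4, lift a (lift b' k) = ix (p k)) ->
  (forall i, A i ord0 = (i == a)%:R) ->
  (forall i, A i (lift ord0 ord0) = (i == b)%:R) ->
  (forall i (k : 'I_4), A i (lift ord0 (lift ord0 k)) = u k 0 i) ->
  \det A = (-1) ^+ (a + b') *
    prod22 (e2 (p (inord 0)) (p (inord 1))) (e2 (p (inord 2)) (p (inord 3)))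
      (u 0) (u 1) (u 2) (u 3).
Proof.
move=> ab pE A0 A1 Au.
rewrite (det_delta_col A0) (@det_delta_col _ _ b'); last first.
  by move=> i; rewrite !mxE A1 -ab (inj_eq lift_inj).
rewrite mulrA -exprD; congr (_ * _).
rewrite /determinant.
pose r k := ix (p (inord k)).
transitivity (\sum_(s : 'S_4) (-1) ^+ s *
   (fun i j k l => u i 0 (r 0) * u j 0 (r 1) * u k 0 (r 2) * u l 0 (r 3))
     (s ord0) (s (lift ord0 ord0)) (s (lift ord0 (lift ord0 ord0)))
     (s (lift ord0 (lift ord0 (lift ord0 ord0))))).
  apply: eq_bigr => s _; congr (_ * _).
  rewrite !big_ord_recl big_ord0 !mxE !Au !pE /r mulr1 !mulrA.
  have sl (i : 'I_4) : p i = p (inord i) by rewrite inord_val.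
  by rewrite !(sl (lift _ _)) (sl ord0).
rewrite (alt_sum4 (fun i j k l =>
  u i 0 (r 0) * u j 0 (r 1) * u k 0 (r 2) * u l 0 (r 3))).
rewrite /prod22 /e2 /r; ring.
Qed.

(** The Hodge dual of the Kaehler form is half its square. *)
Definition star_omega (a b c d : U) : R :=
  2^-1 * prod22 omega omega a b c d.

Lemma alt4_star : alt4 star_omega.
Proof.
by split=> [a|*]; [split=> [b|*]; [split=> *|]|];
  rewrite /star_omega /prod22 /omega /e2 ?row_scale_add; ring.
Qed.

(** The derivation rule turns the differential of F /\ F / 2 into dF /\ F, and
    this is 0: the form dF is a multiple of e^5, and the product of its four
    terms with e^{12} + e^{34} repeats a factor in each term. *)
Lemma d_star_omega (a b c d e : U) :
  star_omega (dstr a b) c d e - star_omega (dstr a c) b d e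
  + star_omega (dstr a d) b c e - star_omega (dstr a e) b c d
  + star_omega (dstr b c) a d e - star_omega (dstr b d) a c e
  + star_omega (dstr b e) a c d + star_omega (dstr c d) a b e
  - star_omega (dstr c e) a b d + star_omega (dstr d e) a b c = 0.
Proof.
transitivity (
    domega a b c * omega d e - domega a b d * omega c e + domega a b e * omega c d
  + domega a c d * omega b e - domega a c e * omega b d + domega a d e * omega b c
  - domega b c d * omega a e + domega b c e * omega a d - domega b d e * omega a c
  + domega c d e * omega a b).
  by rewrite -!domegaE /star_omega /prod22; field.
by rewrite /domega /omega /e3 /e2; ring.
Qed.

Context (M : h19_nilmanifold R).
Local Notation E := (frame M).

Lemma volume_frame x (v : 'I_4 -> U) (i j : 'I_6) (b' : 'I_5) (p : 'I_4 -> nat) :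
  lift i b' = j -> (forall k : 'I_4, lift i (lift b' k) = ix (p k)) ->
  volume M x (fun k : 'I_(2 + 4) => match fintype.split k with
      | inl a => vec2 (E i x) (E j x) a
      | inr b => v b end) =
  (-1) ^+ (i + b') *
    prod22 (e2 (p (inord 0)) (p (inord 1))) (e2 (p (inord 2)) (p (inord 3)))
      (crd M x (v (inord 0))) (crd M x (v (inord 1)))
      (crd M x (v (inord 2))) (crd M x (v (inord 3))).
Proof.
move=> ij pE; rewrite /volume.
apply: (det_delta2 (u := fun k => crd M x (v (inord k))) ij pE) => [r|r|r k].
- rewrite mxE [X in fintype.split X](_ : _ = lshift 4 (ord0 : 'I_2)).
    by rewrite (unsplitK (inl _)) /co dual_frame.
  exact: val_inj.
- rewrite mxE [X in fintype.split X](_ : _ = lshift 4 (lift ord0 ord0 : 'I_2)).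
    by rewrite (unsplitK (inl _)) /co dual_frame.
  exact: val_inj.
rewrite mxE [X in fintype.split X](_ : _ = rshift 2 k); last exact: val_inj.
by rewrite (unsplitK (inr _)) inord_val mxE.
Qed.

Lemma hodge_kaehler x v : hodge2 M (kaehler M) x v =
  star_omega (crd M x (v (inord 0))) (crd M x (v (inord 1)))
    (crd M x (v (inord 2))) (crd M x (v (inord 3))).
Proof.
rewrite /hodge2 exchange_big /=.
have kE i j : kaehler M x (vec2 (E i x) (E j x)) = Jstr (delta_mx 0 j) 0 i.
  rewrite kaehlerE; have [-> ->] := vec2E (E i x) (E j x).
  rewrite !crd_frame -dot_omega /dot (bigD1 i) //= big1 => [|k /negPf ki].
    by rewrite [X in X * _]mxE !eqxx mul1r addr0.
  by rewrite mxE ki andbF mul0r.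
under eq_bigr => j _ do under eq_bigr => i _ do rewrite kE mulrC.
(* only the pairs (1,2), (3,4) and (5,6) contribute, in both orders *)
rewrite trace_J.
pose q (s : seq nat) (k : 'I_4) := nth 0%N s k.
have liftE a b c : (0 < a <= 6)%N -> (b < 5)%N -> bump a.-1 b = c.-1 ->
    (0 < c <= 6)%N -> lift (ix a) (inord b : 'I_5) = ix c.
  by move=> ha hb hc hc'; apply: val_inj; rewrite /= inordK // !val_ix.
have liftE2 a b s : (0 < a <= 6)%N -> (b < 5)%N ->
    [seq bump a.-1 (bump b k) | k <- iota 0 4] = [seq c.-1 | c <- s] ->
    all (fun c => 0 < c <= 6)%N s ->
    forall k : 'I_4, lift (ix a) (lift (inord b : 'I_5) k) = ix (q s k).
  move=> ha hb hs /allP s6 k; apply: val_inj.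
  rewrite /= inordK // !val_ix //; last first.
    apply/s6/mem_nth; move: (congr1 size hs); rewrite !size_map size_iota => <-.
    exact: ltn_ord.
  have := congr1 (fun z => nth 0%N z k) hs.
  have szs : size s = 4 by move: (congr1 size hs); rewrite !size_map size_iota.
  by rewrite !(nth_map 0%N) ?size_iota ?szs ?nth_iota.
rewrite (volume_frame x v (liftE 1 0 2 isT isT erefl isT)
  (liftE2 1 0 [:: 3; 4; 5; 6] isT isT erefl isT))%N.
rewrite (volume_frame x v (liftE 2 0 1 isT isT erefl isT)
  (liftE2 2 0 [:: 3; 4; 5; 6] isT isT erefl isT))%N.
rewrite (volume_frame x v (liftE 3 2 4 isT isT erefl isT)
  (liftE2 3 2 [:: 1; 2; 5; 6] isT isT erefl isT))%N.
rewrite (volume_frame x v (liftE 4 2 3 isT isT erefl isT)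
  (liftE2 4 2 [:: 1; 2; 5; 6] isT isT erefl isT))%N.
rewrite (volume_frame x v (liftE 5 4 6 isT isT erefl isT)
  (liftE2 5 4 [:: 1; 2; 3; 4] isT isT erefl isT))%N.
rewrite (volume_frame x v (liftE 6 4 5 isT isT erefl isT)
  (liftE2 6 4 [:: 1; 2; 3; 4] isT isT erefl isT))%N.
rewrite /q !val_ix // !inordK //= /star_omega /prod22 /omega.
move: (crd M x _) (crd M x _) (crd M x _) (crd M x _) => a b c d.
by rewrite /e2; field.
Qed.

Lemma kaehler_balanced x v : extd (hodge2 M (kaehler M)) x v = 0.
Proof.
by rewrite (extd4 x v hodge_kaehler alt4_star) /=; exact: d_star_omega.
Qed.

End Hodge.

(** * The Bianchi identities and the heterotic equations *)

Section Solutions.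
Context {R : realType} (M : h19_nilmanifold R) (D : connection (R := R)).
Context (lcD : levi_civita M D) (lambda mu : R).
Local Notation V := 'rV[R]_6.
Local Notation A := (A_conn M lambda mu).

Lemma hermitian_balanced : balanced_hermitian M.
Proof.
split=> [x v|x v w|X Y XM YM x|x v].
- by apply: (@crd_inj _ M x); rewrite !crd_cplx Jstr_sqr linearN.
- by rewrite !metricE !crd_cplx dot_Jstr.
- exact: (nijenhuis_eq0 lcD).
- exact: kaehler_balanced.
Qed.

Lemma A_heterotic : heterotic_susy M D A.
Proof.
split; [exact: plus_hol_su3|exact: hermitian_balanced|exact: A_instanton].
Qed.

Lemma pi_neq0 : pi != 0 :> R.
Proof. by rewrite gt_eqF // pi_gt0. Qed.

Lemma bianchi_plus x v : mu ^+ 2 = 4 / 15 ->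
  extd (torsion M) x v =
  4 * pi ^+ 2 * (pontrjagin1 M (nabla_plus M D) x v - pontrjagin1 M A x v).
Proof.
move=> mu2; rewrite d_torsionE (pontrjagin1E (conn_form_plus lcD) plus_form_lin).
rewrite (pontrjagin1E (@conn_form_A _ M lambda mu) (A_form_lin lambda mu)).
(* [field] would compute with the definition of [pi] *)
by rewrite p1_plus p1_A mu2; move: pi pi_neq0 => ? ?; field.
Qed.

Lemma pontrjagin1_A0 x v : mu = 0 -> pontrjagin1 M A x v = 0.
Proof.
move=> mu0.
rewrite (pontrjagin1E (@conn_form_A _ M lambda mu) (A_form_lin lambda mu)).
by rewrite p1_A mu0 expr0n /= mulr0 mul0r mulr0.
Qed.

Lemma bianchi_chern x v : mu = 0 ->
  extd (torsion M) x v =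
  4 * pi ^+ 2 * (pontrjagin1 M (nabla_chern M D) x v - pontrjagin1 M A x v).
Proof.
move=> mu0; rewrite d_torsionE (pontrjagin1E (conn_form_chern lcD) chern_form_lin).
by rewrite pontrjagin1_A0 // p1_chern; move: pi pi_neq0 => ? ?; field.
Qed.

Lemma torsion_neq0 : exists x v, torsion M x v != 0.
Proof.
exists 0, (vec3 (frame M (ix 1) 0) (frame M (ix 3) 0) (frame M (ix 6) 0)).
rewrite torsionE.
have [-> -> ->] := vec3E (frame M (ix 1) 0) (frame M (ix 3) 0) (frame M (ix 6) 0).
rewrite !crd_frame (_ : tors _ _ _ = 2) ?pnatr_eq0 //.
by coords; ring.
Qed.

End Solutions.

Theorem theorem8p2 (R : realType) (M : h19_nilmanifold R)
    (nabla : connection (R := R)) (nabla_lc : levi_civita M nabla)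
    (lambda mu : R) :
  let A := A_conn M lambda mu in
  [/\ mu ^+ 2 = 4 / 15 ->
        forall x v, extd (torsion M) x v =
          4 * pi ^+ 2 * (pontrjagin1 M (nabla_plus M nabla) x v
                         - pontrjagin1 M A x v),
      mu = 0 ->
        (forall x v, pontrjagin1 M A x v = 0) /\
        (forall x v, extd (torsion M) x v =
           4 * pi ^+ 2 * (pontrjagin1 M (nabla_chern M nabla) x v
                          - pontrjagin1 M A x v)) &
      [/\ heterotic_susy M nabla A,
          exists x v, torsion M x v != 0,
          mu ^+ 2 = 4 / 15 -> bianchi M (nabla_plus M nabla) A &
          mu = 0 -> bianchi M (nabla_chern M nabla) A]].
Proof.
move=> A.
have alpha : 4 * pi ^+ 2 = 2 / 4 * (8 * pi ^+ 2) :> R.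
  by move: (pi : R) => ?; field.
split=> [mu2 x v|mu0|].
- exact: bianchi_plus.
- by split=> x v; [exact: pontrjagin1_A0|exact: bianchi_chern].
split; [exact: A_heterotic|exact: torsion_neq0|move=> mu2|move=> mu0].
(* alpha' = 2 *)
- by exists 2 => // x v; rewrite -alpha; exact: bianchi_plus.
- by exists 2 => // x v; rewrite -alpha; exact: bianchi_chern.
Qed.
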